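(* Let $P$ be a continuous poset and $(T_\varepsilon)_{\varepsilon\ge0}$ a superlinear family of Scott-continuous translations satisfying TR1 and TR2. Then for all Scott sheaves $\mathcal F,\mathcal G$ on $P^\sigma$ and all persistence modules $M,N$ over $P$: (i) $d_\sigma(\mathcal F,\mathcal G)=d_a(j^*\mathcal F,j^*\mathcal G)=d_a(j^!\mathcal F,j^!\mathcal G)$; (ii) $d_a(M,N)=d_a(\underline M,\underline N)$; (iii) $d_a(M,N)=d_a(\overline M,\overline N)$; (iv) $d_a(M,N)=d_\sigma(j_*M,j_*N)$.
   Context: Let $P$ be a poset (as a category, $p\to q$ iff $p\le q$). A subset is directed if nonempty and any two elements have an upper bound in it. $x\ll y$ means: for every directed $D$ whose supremum exists with $y\le\sup D$, some $d\in D$ satisfies $x\le d$. $P$ is continuous if for each $p$ the set $\{x:x\ll p\}$ is directed with supremum $p$. $U_p=\{x\ge p\}$. $U$ is Scott-open if it is an up-set meeting every directed set whose supremum exists and lies in $U$; $P^\sigma$ is $P$ with this topology, $\mathrm{Int}$ the Scott interior. A map $f\colon P\to P$ is Scott-continuous if order-preserving and $f(\sup D)=\sup f(D)$ for directed $D$ with existing supremum (equivalently, continuous on $P^\sigma$). A translation is an order-preserving $T$ with $p\le T(p)$; a family $(T_\varepsilon)_{\varepsilon\ge0}$ is superlinear if $T_\varepsilon(T_\delta(p))\le T_{\varepsilon+\delta}(p)$. TR1: each $T_\varepsilon$ is an order-isomorphism. TR2: $x\ll T_\varepsilon(x)$ for all $x$ and $\varepsilon>0$. $k$ is a commutative ring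 with unity; persistence modules are functors from $P$ to $k$-modules; Scott sheaves are sheaves of $k$-modules on $P^\sigma$. For a persistence module, $T^*M=M\circ T$ with natural morphism $M\to T^*M$ given by $M(p\le T(p))$; for a Scott sheaf, $T^*\mathcal F$ is the sheaf inverse image along $T\colon P^\sigma\to P^\sigma$, with natural morphism $\mathcal F\to T^*\mathcal F$ induced on stalks by $\mathcal F_p\to\mathcal F_{T(p)}$ (every Scott-open neighbourhood of $p$ contains $T(p)$). Objects $A,B$ (both persistence modules or both Scott sheaves) are $\varepsilon$-interleaved if there are morphisms $f\colon A\to T_\varepsilon^*B$, $g\colon B\to T_\varepsilon^*A$ with $T_\varepsilon^*(g)\circ f$ and $T_\varepsilon^*(f)\circ g$ equal to the natural morphisms $A\to T_\varepsilon^*T_\varepsilon^*A$ and $B\to T_\varepsilon^*T_\varepsilon^*B$. The interleaving distance is the infimum of such $\varepsilon$ ($\infty$ if none): $d_a$ for persistence modules, $d_\sigma$ for Scott sheaves. For $M(U)=\varprojlim_{x\in U}M_x$: $j_*M$ is the Scott sheaf $U\mapsto M(U)$; $j^*\mathcal F$ is the persistence module of stalks $p\mapsto\mathcal F_p$; $j^!\mathcal F$ is $p\mapsto\mathcal F(\mathrm{Int}\,U_p)$ with restrictions. $\underline M_p=\varprojlim_{x\gg p}M_x$, $\overline M_p=\varinjlim_{x\ll p}M_x$. *)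

(* Defs.v *)
From HB Require Import structures.
From mathcomp Require Import all_boot all_order all_algebra.
From mathcomp Require Import classical_sets reals ereal.
Set Implicit Arguments. Unset Strict Implicit. Unset Printing Implicit Defensive.
Import Order.TTheory GRing.Theory Num.Theory.

(* k-modules, presented as PER-setoids: the elements of the module are the  *)
(* x with [meq x x]; [meq] is the equality of the module.  This lets limits,*)
(* colimits, stalks, inverse images be written down as plain data.          *)
Section Modules.
Variable k : comPzRingType.
Local Open Scope ring_scope.

Record Mod := { car : Type; meq : car -> car -> Prop; mzero : car;
  madd : car -> car -> car; mopp : car -> car; mscale : k -> car -> car }.

Definition mdom (M : Mod) (x : car M) := meq x x.

Definition IsMod (M : Mod) : Prop :=
  (forall x y : car M, meq x y -> meq y x) /\
  (forall x y z : car M, meq x y -> meq y z -> meq x z) /\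
  mdom (mzero M) /\
  (forall x x' y y' : car M, meq x x' -> meq y y' -> meq (madd x y) (madd x' y')) /\
  (forall x x' : car M, meq x x' -> meq (mopp x) (mopp x')) /\
  (forall a (x x' : car M), meq x x' -> meq (mscale a x) (mscale a x')) /\
  (forall x y z, mdom x -> mdom y -> mdom z ->
        [/\ meq (madd x (madd y z)) (madd (madd x y) z),
            meq (madd x y) (madd y x),
            meq (madd (mzero M) x) x,
            meq (madd (mopp x) x) (mzero M) &
        forall a b : k,
        [/\ meq (mscale 1 x) x,
            meq (mscale (a * b) x) (mscale a (mscale b x)),
            meq (mscale a (madd x y)) (madd (mscale a x) (mscale a y)) &
            meq (mscale (a + b) x) (madd (mscale a x) (mscale b x))]]).

Definition IsLin (M N : Mod) (f : car M -> car N) : Prop :=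
  [/\ (forall x y, meq x y -> meq (f x) (f y)),
      (forall x y, mdom x -> mdom y -> meq (f (madd x y)) (madd (f x) (f y))) &
      (forall a x, mdom x -> meq (f (mscale a x)) (mscale a (f x)))].

Fixpoint msum (M : Mod) (l : seq (car M)) : car M :=
  if l is x :: l' then madd x (msum l') else mzero M.

End Modules.

Fixpoint InL (A : Type) (x : A) (l : seq A) : Prop :=
  if l is y :: l' then y = x \/ InL x l' else False.


Section Poset.
Context {d : Order.disp_t} {P : porderType d}.
Local Open Scope order_scope.

Definition Directed (D : P -> Prop) : Prop :=
  (exists x, D x) /\
  forall a b, D a -> D b -> exists c, [/\ D c, a <= c & b <= c].

Definition IsSup (D : P -> Prop) (s : P) : Prop :=
  (forall x, D x -> x <= s) /\ (forall u, (forall x, D x -> x <= u) -> s <= u).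

Definition way_below (x y : P) : Prop :=
  forall D s, Directed D -> IsSup D s -> y <= s -> exists2 e, D e & x <= e.

Definition ContinuousPoset : Prop :=
  forall p, Directed (fun x => way_below x p) /\ IsSup (fun x => way_below x p) p.

Definition ScottOpen (U : P -> Prop) : Prop :=
  (forall x y, U x -> x <= y -> U y) /\
  (forall D s, Directed D -> IsSup D s -> U s -> exists2 e, D e & U e).

Definition ScottInt (U : P -> Prop) : P -> Prop :=
  fun x => exists V, [/\ ScottOpen V, (forall y, V y -> U y) & V x].

Definition Up (p : P) : P -> Prop := fun x => p <= x.

Definition ScottContinuous (f : P -> P) : Prop :=
  (forall x y, x <= y -> f x <= f y) /\
  (forall D s, Directed D -> IsSup D s ->
     IsSup (fun y => exists2 x, D x & y = f x) (f s)).

Definition Translation (T : P -> P) : Prop :=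
  (forall x y, x <= y -> T x <= T y) /\ (forall x, x <= T x).

Definition OrderIso (T : P -> P) : Prop :=
  (exists g, cancel T g /\ cancel g T) /\ (forall x y, (T x <= T y) = (x <= y)).

End Poset.

Section Persistence.
Variable k : comPzRingType.
Variables (d : Order.disp_t) (P : porderType d).
Local Open Scope order_scope.

(* a persistence module: values and structure maps M(p <= q) (the latter are
   only constrained when p <= q) *)
Record PMod := { pm : P -> Mod k; pmap : forall p q : P, car (pm p) -> car (pm q) }.
Arguments pmap : clear implicits.

Definition IsPMod (M : PMod) : Prop :=
  [/\ (forall p, IsMod (pm M p)),
      (forall p q, p <= q -> IsLin (pmap M p q)),
      (forall p x, mdom x -> meq (pmap M p p x) x) &
      (forall p q r, p <= q -> q <= r -> forall x, mdom x ->
          meq (pmap M q r (pmap M p q x)) (pmap M p r x))].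

Definition pull_pm (T : P -> P) (M : PMod) : PMod :=
  {| pm := fun p => pm M (T p); pmap := fun p q => pmap M (T p) (T q) |}.

Definition IsPMor (M N : PMod) (f : forall p, car (pm M p) -> car (pm N p)) : Prop :=
  (forall p, IsLin (f p)) /\
  (forall p q, p <= q -> forall x, mdom x ->
      meq (pmap N p q (f p x)) (f q (pmap M p q x))).

Definition pm_interleaved (T : P -> P) (M N : PMod) : Prop :=
  exists (f : forall p, car (pm M p) -> car (pm (pull_pm T N) p))
         (g : forall p, car (pm N p) -> car (pm (pull_pm T M) p)),
  [/\ IsPMor f, IsPMor g,
      (forall p x, mdom x -> meq (g (T p) (f p x)) (pmap M p (T (T p)) x)) &
      (forall p x, mdom x -> meq (f (T p) (g p x)) (pmap N p (T (T p)) x))].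

(* Scott sheaves: sections on every subset, only constrained on Scott-open
   ones; restriction maps res U V (constrained when V is a subset of U) *)
Record Sheaf := { sec : (P -> Prop) -> Mod k;
                  res : forall U V : P -> Prop, car (sec U) -> car (sec V) }.
Arguments res : clear implicits.

Definition subs (U V : P -> Prop) := forall x, U x -> V x.
Definition capS (U V : P -> Prop) : P -> Prop := fun x => U x /\ V x.

Definition IsSheaf (F : Sheaf) : Prop :=
  [/\ (forall U, ScottOpen U -> IsMod (sec F U)),
      (forall U V, ScottOpen U -> ScottOpen V -> subs V U -> IsLin (res F U V)),
      (forall U, ScottOpen U -> forall s, mdom s -> meq (res F U U s) s),
      (forall U V W, ScottOpen U -> ScottOpen V -> ScottOpen W ->
         subs V U -> subs W V -> forall s, mdom s ->
         meq (res F V W (res F U V s)) (res F U W s)) &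
      (forall U (C : (P -> Prop) -> Prop), ScottOpen U ->
         (forall V, C V -> ScottOpen V /\ subs V U) ->
         (forall x, U x -> exists2 V, C V & V x) ->
         (forall s t, mdom s -> mdom t ->
            (forall V, C V -> meq (res F U V s) (res F U V t)) -> meq s t) /\
         (forall sf : forall V, car (sec F V),
            (forall V, C V -> mdom (sf V)) ->
            (forall V W, C V -> C W ->
               meq (res F V (capS V W) (sf V)) (res F W (capS V W) (sf W))) ->
            exists2 t, mdom t & forall V, C V -> meq (res F U V t) (sf V)))].

Definition stalk (F : Sheaf) (p : P) : Mod k :=
  {| car := {U : P -> Prop & car (sec F U)};
     meq := fun a b =>
       [/\ ScottOpen (projT1 a) /\ projT1 a p, mdom (projT2 a),
           ScottOpen (projT1 b) /\ projT1 b p, mdom (projT2 b) &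
           exists W, [/\ ScottOpen W, W p, subs W (projT1 a), subs W (projT1 b) &
             meq (res F (projT1 a) W (projT2 a)) (res F (projT1 b) W (projT2 b))]];
     mzero := existT _ (fun _ => True) (mzero (sec F (fun _ => True)));
     madd := fun a b => existT _ (capS (projT1 a) (projT1 b))
        (madd (res F (projT1 a) (capS (projT1 a) (projT1 b)) (projT2 a))
              (res F (projT1 b) (capS (projT1 a) (projT1 b)) (projT2 b)));
     mopp := fun a => existT _ (projT1 a) (mopp (projT2 a));
     mscale := fun c a => existT _ (projT1 a) (mscale c (projT2 a)) |}.

(* j^* F : p |-> F_p, structure maps induced by F_p -> F_q (germs stay germs) *)
Definition jstar (F : Sheaf) : PMod :=
  {| pm := stalk F; pmap := fun p q a => a |}.

Definition jshriek (F : Sheaf) : PMod :=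
  {| pm := fun p => sec F (ScottInt (Up p));
     pmap := fun p q => res F (ScottInt (Up p)) (ScottInt (Up q)) |}.

Definition limMod (M : PMod) (D : P -> Prop) : Mod k :=
  let compat (f : forall x, car (pm M x)) :=
    (forall x, D x -> mdom (f x)) /\
    (forall x y, D x -> D y -> x <= y -> meq (pmap M x y (f x)) (f y)) in
  {| car := forall x, car (pm M x);
     meq := fun f g => [/\ compat f, compat g & forall x, D x -> meq (f x) (g x)];
     mzero := fun x => mzero (pm M x);
     madd := fun f g x => madd (f x) (g x);
     mopp := fun f x => mopp (f x);
     mscale := fun c f x => mscale c (f x) |}.

(* colimit of M over the (directed) full subposet D, by formal finite sums *)
Definition colimMod (M : PMod) (D : P -> Prop) : Mod k :=
  let good (l : seq {x : P & car (pm M x)}) :=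
    forall e, InL e l -> D (projT1 e) /\ mdom (projT2 e) in
  let push z (l : seq {x : P & car (pm M x)}) :=
    msum [seq pmap M (projT1 e) z (projT2 e) | e <- l] in
  {| car := seq {x : P & car (pm M x)};
     meq := fun l1 l2 => [/\ good l1, good l2 &
        exists z, [/\ D z, (forall e, InL e (l1 ++ l2) -> projT1 e <= z) &
                      meq (push z l1) (push z l2)]];
     mzero := [::];
     madd := fun l1 l2 => l1 ++ l2;
     mopp := fun l => [seq existT (fun x => car (pm M x)) (projT1 e) (mopp (projT2 e)) | e <- l];
     mscale := fun c l => [seq existT (fun x => car (pm M x)) (projT1 e) (mscale c (projT2 e)) | e <- l] |}.

Definition under_pm (M : PMod) : PMod :=
  {| pm := fun p => limMod M (fun x => way_below p x); pmap := fun p q f => f |}.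

Definition over_pm (M : PMod) : PMod :=
  {| pm := fun p => colimMod M (fun x => way_below x p); pmap := fun p q l => l |}.

Definition jlow (M : PMod) : Sheaf :=
  {| sec := fun U => limMod M U; res := fun U V f => f |}.

Definition germ_map (F G : Sheaf) (f : forall U, car (sec F U) -> car (sec G U))
  (p : P) (a : car (stalk F p)) : car (stalk G p) :=
  existT _ (projT1 a) (f (projT1 a) (projT2 a)).

(* sheaf inverse image T^* F along T : P^sigma -> P^sigma, as the sheaf of
   continuous sections of the etale space: sections over U are maps
   p |-> germ in F_{T p} which are locally induced by a section of F. *)
Definition pull_sh (T : P -> P) (F : Sheaf) : Sheaf :=
  let loc (U : P -> Prop) (s : forall p, car (stalk F (T p))) :=
    forall p, U p -> exists W, [/\ ScottOpen W, W p, subs W U &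
      exists V (sg : car (sec F V)),
        [/\ ScottOpen V, (forall q, W q -> V (T q)), mdom sg &
            forall q, W q -> meq (s q) (existT _ V sg : car (stalk F (T q)))]] in
  {| sec := fun U =>
       {| car := forall p, car (stalk F (T p));
          meq := fun s t => [/\ loc U s, loc U t & forall p, U p -> meq (s p) (t p)];
          mzero := fun p => mzero (stalk F (T p));
          madd := fun s t p => madd (s p) (t p);
          mopp := fun s p => mopp (s p);
          mscale := fun c s p => mscale c (s p) |};
     res := fun U V s => s |}.

Definition nat_sh (T : P -> P) (F : Sheaf) (U : P -> Prop)
  (s : car (sec F U)) : car (sec (pull_sh T F) U) :=
  fun p => existT _ U s.

Definition pull_mor (T : P -> P) (G H : Sheaf)
  (g : forall U, car (sec G U) -> car (sec H U)) (U : P -> Prop)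
  (s : car (sec (pull_sh T G) U)) : car (sec (pull_sh T H) U) :=
  fun p => germ_map g (s p).

Definition IsShMor (F G : Sheaf) (f : forall U, car (sec F U) -> car (sec G U)) : Prop :=
  (forall U, ScottOpen U -> IsLin (f U)) /\
  (forall U V, ScottOpen U -> ScottOpen V -> subs V U -> forall s, mdom s ->
     meq (res G U V (f U s)) (f V (res F U V s))).

Definition sh_interleaved (T : P -> P) (F G : Sheaf) : Prop :=
  exists (f : forall U, car (sec F U) -> car (sec (pull_sh T G) U))
         (g : forall U, car (sec G U) -> car (sec (pull_sh T F) U)),
  [/\ IsShMor f, IsShMor g,
      (forall U, ScottOpen U -> forall s, mdom s ->
         meq (pull_mor g (f U s)) (nat_sh T (nat_sh T s))) &
      (forall U, ScottOpen U -> forall s, mdom s ->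
         meq (pull_mor f (g U s)) (nat_sh T (nat_sh T s)))].

End Persistence.

Section Distances.
Variable k : comPzRingType.
Context {d : Order.disp_t} {P : porderType d} {R : realType}.
Local Open Scope ring_scope.

Definition d_a (T : R -> P -> P) (M N : PMod k P) : \bar R :=
  ereal_inf [set e%:E | e in [set e : R | 0 <= e /\ pm_interleaved (T e) M N]].

Definition d_sigma (T : R -> P -> P) (F G : Sheaf k P) : \bar R :=
  ereal_inf [set e%:E | e in [set e : R | 0 <= e /\ sh_interleaved (T e) F G]].

Definition SuperlinearFamily (T : R -> P -> P) : Prop :=
  forall e e' : R, 0 <= e -> 0 <= e' -> forall p, (T e (T e' p) <= T (e + e') p)%O.

Definition TR1 (T : R -> P -> P) : Prop := forall e : R, 0 <= e -> OrderIso (T e).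
Definition TR2 (T : R -> P -> P) : Prop :=
  forall e : R, 0 < e -> forall x, way_below x (T e x).

End Distances.

(* Main.v *)
(** Every equality follows from the triangle inequality for [d_a] once the
    modules compared are [e]-interleaved for every [e > 0]. The comparison maps
    exist because [p << T_e p]: a section on the interior of [U_p], or a
    compatible family on the points way above [p], can be evaluated at [T_e p],
    and a value at [p] represents an element of the colimit over the points way
    below [T_e p]. Passing from sheaves to modules loses nothing: on a continuous
    poset a natural family of maps of stalks is automatically a sheaf morphism
    into the inverse image, so interleavings of sheaves and of their stalk
    modules are the same thing.

    Interleavings use only that module equalities are partial equivalence
    relations respected by sums and scalings and that structure maps are
    functorial; [IsCong], [IsPrePMod] and [IsPresheaf] record just this. *)
Require Import Defs.
From mathcomp Require Import all_boot all_order all_algebra.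
From mathcomp Require Import classical_sets reals ereal.
Import Order.TTheory GRing.Theory Num.Theory.
Set Implicit Arguments. Unset Strict Implicit. Unset Printing Implicit Defensive.

Local Notation "M $[ p --> q ] x" := (@Defs.pmap _ _ _ M p q x)
  (at level 10, p at level 50, q at level 50, x at level 9, format "M  $[ p  -->  q ]  x").

(** * Modules up to a partial equivalence, and linear maps *)

Section Modules.
Variable k : comPzRingType.

Record IsCong (M : Mod k) : Prop := {
  cong_sym : forall x y : car M, meq x y -> meq y x;
  cong_trans : forall x y z : car M, meq x y -> meq y z -> meq x z;
  cong_add : forall x x' y y' : car M,
    meq x x' -> meq y y' -> meq (madd x y) (madd x' y');
  cong_scale : forall a (x x' : car M),
    meq x x' -> meq (mscale a x) (mscale a x') }.

Lemma IsMod_cong (M : Mod k) : IsMod M -> IsCong M.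
Proof. by case=> ? [? [_ [? [_ [? _]]]]]. Qed.

Section Cong.
Variable M : Mod k.
Hypothesis hM : IsCong M.

Lemma cong_doml (x y : car M) : meq x y -> mdom x.
Proof. by move=> xy; apply: (cong_trans hM xy); apply: cong_sym. Qed.

Lemma cong_domr (x y : car M) : meq x y -> mdom y.
Proof. by move/(cong_sym hM)/cong_doml. Qed.

End Cong.

Lemma lin_meq (M N : Mod k) (f : car M -> car N) (x y : car M) :
  IsLin f -> meq x y -> meq (f x) (f y).
Proof. by case=> + _ _; apply. Qed.

Lemma lin_comp (A B C : Mod k) (f : car A -> car B) (g : car B -> car C) :
  IsCong C -> IsLin f -> IsLin g -> IsLin (fun x => g (f x)).
Proof.
move=> hC [f1 f2 f3] [g1 g2 g3]; split.
- by move=> x y xy; apply/g1/f1.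
- move=> x y hx hy; apply: (cong_trans hC (g1 _ _ (f2 _ _ hx hy))).
  by apply: g2; apply: f1.
- move=> a x hx; apply: (cong_trans hC (g1 _ _ (f3 _ _ hx))).
  by apply: g3; apply: f1.
Qed.

(** [IsLin] does not list zero. From f 0 + f 0 = f 0 one cancels by adding the opposite of f 0,
    which takes the full module axioms. Colimits need this for the empty formal sum. *)
Lemma lin0 (M N : Mod k) (f : car M -> car N) :
  IsMod M -> IsMod N -> IsLin f -> meq (f (mzero M)) (mzero N).
Proof.
move=> hM hN hf; have cN := IsMod_cong hN.
case: hM => _ [_ [dM0 [_ [_ [_ axM]]]]].
case: hN => _ [_ [dN0 [_ [oppN [_ axN]]]]].
have df0 : mdom (f (mzero M)) by apply: (lin_meq hf).
have [_ _ M00 _ _] := axM _ _ _ dM0 dM0 dM0.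
have ff : meq (madd (f (mzero M)) (f (mzero M))) (f (mzero M)).
  apply: (cong_trans cN (cong_sym cN _) (lin_meq hf M00)).
  by case: hf => _ + _; apply.
have dof : mdom (mopp (f (mzero M))) by apply: oppN.
have [assoc _ _ oppf _] := axN _ _ _ df0 df0 df0.
have [assoc' _ f0 _ _] := axN _ _ _ df0 df0 df0.
have [assoc2 _ _ _ _] := axN _ _ _ dof df0 df0.
apply: (cong_trans cN (cong_sym cN f0)).
apply: (cong_trans cN (cong_add cN (cong_sym cN oppf) df0)).
apply: (cong_trans cN (cong_sym cN assoc2)).
by apply: (cong_trans cN (cong_add cN dof ff)).
Qed.

End Modules.

(** * Persistence modules and composition of interleavings *)

Section PMods.
Context {k : comPzRingType} {d : Order.disp_t} {P : porderType d}.
Local Open Scope order_scope.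
Implicit Types (M N A B C : PMod k P) (p q r : P).

Record IsPrePMod M : Prop := {
  pre_cong : forall p, IsCong (pm M p);
  pre_lin : forall p q, p <= q -> IsLin (@Defs.pmap _ _ _ M p q);
  pre_id : forall p x, mdom x -> meq (M $[p --> p] x) x;
  pre_comp : forall p q r, p <= q -> q <= r -> forall x, mdom x ->
    meq (M $[q --> r] (M $[p --> q] x)) (M $[p --> r] x) }.

Lemma IsPMod_pre M : IsPMod M -> IsPrePMod M.
Proof. by case=> h *; split=> // p; apply: IsMod_cong. Qed.

Lemma pre_trans M (hM : IsPrePMod M) p (x y z : car (pm M p)) :
  meq x y -> meq y z -> meq x z.
Proof. exact: (cong_trans (pre_cong hM p)). Qed.

Lemma pre_sym M (hM : IsPrePMod M) p (x y : car (pm M p)) : meq x y -> meq y x.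
Proof. exact: (cong_sym (pre_cong hM p)). Qed.

Lemma pre_meq M (hM : IsPrePMod M) p q (x y : car (pm M p)) :
  p <= q -> meq x y -> meq (M $[p --> q] x) (M $[p --> q] y).
Proof. by move=> pq; apply: lin_meq; apply: pre_lin. Qed.

Lemma mor_meq A B (f : forall p, car (pm A p) -> car (pm B p)) :
  IsPMor f -> forall p x y, meq x y -> meq (f p x) (f p y).
Proof. by move=> [h _] p x y; apply: lin_meq. Qed.

(** The target is shifted by an upper bound [S] of the composite shift, because superlinearity gives
    only an inequality; a structure map of [C] bridges the gap. *)
Lemma pmor_comp A B C (T1 T2 S : P -> P)
    (f : forall p, car (pm A p) -> car (pm (pull_pm T1 B) p))
    (f' : forall p, car (pm B p) -> car (pm (pull_pm T2 C) p)) :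
  IsPrePMod A -> IsPrePMod C -> Translation T1 -> Translation T2 -> Translation S ->
  (forall p, T2 (T1 p) <= S p) -> IsPMor f -> IsPMor f' ->
  IsPMor (M := A) (N := pull_pm S C)
    (fun p x => C $[T2 (T1 p) --> S p] (f' (T1 p) (f p x))).
Proof.
move=> hA hC [m1 _] [m2 _] [mS _] le_S hf hf'; split=> [p|p q pq x hx].
  apply: (lin_comp (pre_cong hC (S p)) _ (pre_lin hC (le_S p))).
  apply: (lin_comp (f := f p)); [exact: (pre_cong hC) | exact: hf.1 | exact: hf'.1].
have df : mdom (f p x) by apply: (mor_meq hf).
have df' : mdom (f' (T1 p) (f p x)) by apply: (mor_meq hf').
have T12 : T2 (T1 p) <= T2 (T1 q) by apply/m2/m1.
apply: (pre_trans hC (pre_comp hC (le_S p) (mS _ _ pq) df')).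
apply: (pre_trans hC (pre_sym hC (pre_comp hC T12 (le_S q) df'))).
apply: (pre_meq hC (le_S q)).
apply: (pre_trans hC (hf'.2 _ _ (m1 _ _ pq) _ df)).
by apply: (mor_meq hf'); apply: hf.2.
Qed.

(** One of the two identities for a composed interleaving; the other follows by exchanging roles.
    Naturality moves every structure map to the outside, the inner and then the outer pair of maps
    collapses, and functoriality merges what remains. *)
Lemma interleaving_comp A B C (T1 T2 S : P -> P)
    (f : forall p, car (pm A p) -> car (pm (pull_pm T1 B) p))
    (g : forall p, car (pm B p) -> car (pm (pull_pm T1 A) p))
    (f' : forall p, car (pm B p) -> car (pm (pull_pm T2 C) p))
    (g' : forall p, car (pm C p) -> car (pm (pull_pm T2 B) p)) :
  IsPrePMod A -> IsPrePMod B -> IsPrePMod C ->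
  Translation T1 -> Translation T2 -> Translation S ->
  (forall p, T2 (T1 p) <= S p) -> (forall p, T1 (T2 p) <= S p) ->
  IsPMor f -> IsPMor g -> IsPMor f' -> IsPMor g' ->
  (forall p x, mdom x -> meq (g (T1 p) (f p x)) (A $[p --> T1 (T1 p)] x)) ->
  (forall p x, mdom x -> meq (g' (T2 p) (f' p x)) (B $[p --> T2 (T2 p)] x)) ->
  forall p x, mdom x ->
    meq (A $[T1 (T2 (S p)) --> S (S p)] (g (T2 (S p)) (g' (S p)
          (C $[T2 (T1 p) --> S p] (f' (T1 p) (f p x))))))
        (A $[p --> S (S p)] x).
Proof.
move=> hA hB hC t1 t2 tS le21 le12 hf hg hf' hg' gf gf' p x hx.
have [m1 i1] := t1; have [m2 i2] := t2; have [mS iS] := tS.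
have hG := pmor_comp hC hA t2 t1 tS le12 hg' hg.
set u := T2 (T1 p).
have df : mdom (f p x) by apply: (mor_meq hf).
have df' : mdom (f' (T1 p) (f p x)) by apply: (mor_meq hf').
(* Naturality of the composed return map takes the structure map of [C] out, so that [g'] meets [f']
   directly. *)
apply: (pre_trans hA (pre_sym hA (hG.2 _ _ (le21 p) _ df'))).
have dg' : mdom (g' u (f' (T1 p) (f p x))) by apply: (mor_meq hg').
have dg : mdom (g (T2 u) (g' u (f' (T1 p) (f p x)))) by apply: (mor_meq hg).
have u_le : T1 (T2 u) <= S (S p) by apply: le_trans (le12 u) (mS _ _ (le21 p)).
apply: (pre_trans hA (pre_comp hA (le12 u) (mS _ _ (le21 p)) dg)).
have e1 : meq (g (T2 u) (g' u (f' (T1 p) (f p x))))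
              (g (T2 u) (B $[T1 p --> T2 u] (f p x))).
  exact: (mor_meq hg (gf' (T1 p) (f p x) df)).
apply: (pre_trans hA (pre_meq hA u_le e1)).
have le1u : T1 p <= T2 u by apply: le_trans (i2 _) (i2 _).
(* The structure map of [B] left by the inner pair passes through [g], so that [g] meets [f]. *)
have e2 := pre_sym hA (hg.2 _ _ le1u _ df).
apply: (pre_trans hA (pre_meq hA u_le e2)).
have dgf : mdom (g (T1 p) (f p x)) by apply: (mor_meq hg).
have le_tu : T1 (T1 p) <= T1 (T2 u) by apply: m1.
apply: (pre_trans hA (pre_comp hA le_tu u_le dgf)).
apply: (pre_trans hA (pre_meq hA (le_trans le_tu u_le) (gf p x hx))).
apply: (pre_comp hA _ _ hx); last exact: le_trans le_tu u_le.
exact: le_trans (i1 _) (i1 _).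
Qed.

Lemma pm_interleaved_trans A B C (T1 T2 S : P -> P) :
  IsPrePMod A -> IsPrePMod B -> IsPrePMod C ->
  Translation T1 -> Translation T2 -> Translation S ->
  (forall p, T2 (T1 p) <= S p) -> (forall p, T1 (T2 p) <= S p) ->
  pm_interleaved T1 A B -> pm_interleaved T2 B C -> pm_interleaved S A C.
Proof.
move=> hA hB hC t1 t2 tS le21 le12 [f [g [hf hg gf fg]]] [f' [g' [hf' hg' gf' fg']]].
exists (fun p x => C $[T2 (T1 p) --> S p] (f' (T1 p) (f p x))).
exists (fun p x => A $[T1 (T2 p) --> S p] (g (T2 p) (g' p x))).
split; [exact: pmor_comp|exact: pmor_comp| |].
- exact: (interleaving_comp hA hB hC t1 t2 tS le21 le12 hf hg hf' hg' gf gf').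
- exact: (interleaving_comp hC hB hA t2 t1 tS le12 le21 hg' hf' hg hf fg' fg).
Qed.

Lemma pm_interleaved_sym A B (T : P -> P) :
  pm_interleaved T A B -> pm_interleaved T B A.
Proof. by case=> f [g [hf hg gf fg]]; exists g, f. Qed.

(** If one comparison map needs no shift, following it by a structure map completes an interleaving.
    Every comparison between a module and its variants below has this one-sided form. *)
Lemma pm_interleaved_factor A B (T : P -> P)
    (a : forall p, car (pm A p) -> car (pm B p))
    (b : forall p, car (pm B p) -> car (pm (pull_pm T A) p)) :
  IsPrePMod A -> IsPrePMod B -> Translation T -> IsPMor a -> IsPMor b ->
  (forall p x, mdom x -> meq (b p (a p x)) (A $[p --> T p] x)) ->
  (forall p x, mdom x -> meq (a (T p) (b p x)) (B $[p --> T p] x)) ->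
  pm_interleaved T A B.
Proof.
move=> hA hB [mT iT] ha hb ba ab.
exists (fun p x => B $[p --> T p] (a p x)), b; split=> // [|p x hx|p x hx].
- split=> [p|p q pq x hx].
    apply: (lin_comp (f := a p)); [exact: (pre_cong hB)|exact: ha.1|exact: (pre_lin hB)].
  have da : mdom (a p x) by apply: (mor_meq ha).
  apply: (pre_trans hB (pre_comp hB (iT p) (mT _ _ pq) da)).
  apply: (pre_trans hB (pre_sym hB (pre_comp hB pq (iT q) da))).
  by apply: (pre_meq hB (iT q)); apply: ha.2.
- have da : mdom (a p x) by apply: (mor_meq ha).
  apply: (pre_trans hA (pre_sym hA (hb.2 _ _ (iT p) _ da))).
  apply: (pre_trans hA (pre_meq hA (mT _ _ (iT p)) (ba p x hx))).
  exact: (pre_comp hA).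
- apply: (pre_trans hB (pre_meq hB (iT _) (ab p x hx))).
  exact: (pre_comp hB).
Qed.

End PMods.

(** * The triangle inequality for the interleaving distance *)

Section Distance.
Context {k : comPzRingType} {d : Order.disp_t} {P : porderType d} {R : realType}.
Variable T : R -> P -> P.
Local Open Scope ring_scope.
Hypothesis trT : forall e : R, 0 <= e -> Translation (T e).
Hypothesis slT : SuperlinearFamily T.
Implicit Types (A B : PMod k P).

Definition infinitesimally_interleaved A B : Prop :=
  forall e : R, 0 < e -> pm_interleaved (T e) A B.

Lemma pm_interleaved_add A B C (e e' : R) :
  IsPrePMod A -> IsPrePMod B -> IsPrePMod C -> 0 <= e -> 0 <= e' ->
  pm_interleaved (T e) A B -> pm_interleaved (T e') B C ->
  pm_interleaved (T (e + e')) A C.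
Proof.
move=> hA hB hC he he'; apply: pm_interleaved_trans => //.
- exact: trT.
- exact: trT.
- by apply: trT; apply: addr_ge0.
- by move=> p; rewrite addrC; apply: slT.
- by move=> p; apply: slT.
Qed.

(** The chain from [A'] through [A] and [B] to [B'] costs [r / 2] at each end, so an interleaving of
    [A] and [B] at [e] gives one of [A'] and [B'] at [e + r], for every [r > 0]. *)
Lemma d_a_le_infinitesimal A B A' B' :
  IsPrePMod A -> IsPrePMod B -> IsPrePMod A' -> IsPrePMod B' ->
  infinitesimally_interleaved A' A -> infinitesimally_interleaved B B' ->
  (d_a T A' B' <= d_a T A B)%E.
Proof.
move=> hA hB hA' hB' hAA hBB; apply/ereal_infP => _ [e [he eAB] <-].
apply/lee_addgt0Pr => r r0.
have r20 : 0 < r / 2 by rewrite divr_gt0.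
apply: ereal_inf_lbound; exists (r / 2 + e + r / 2).
  split; first by rewrite !addr_ge0 // ltW.
  apply: (pm_interleaved_add hA' hB hB'); [|exact: ltW| |exact: hBB].
    by rewrite addr_ge0 // ltW.
  by apply: (pm_interleaved_add hA' hA hB) => //; [exact: ltW|exact: hAA].
by rewrite addrAC -splitr addrC.
Qed.

Lemma d_a_infinitesimal A B A' B' :
  IsPrePMod A -> IsPrePMod B -> IsPrePMod A' -> IsPrePMod B' ->
  infinitesimally_interleaved A A' -> infinitesimally_interleaved B B' ->
  d_a T A B = d_a T A' B'.
Proof.
move=> hA hB hA' hB' hAA hBB; apply/eqP; rewrite eq_le.
apply/andP; split; apply: d_a_le_infinitesimal => // e he; apply: pm_interleaved_sym.
- exact: hBB.
- exact: hAA.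
Qed.

End Distance.

(** * Scott-open sets and the way-below relation *)

Section ScottTopology.
Context {d : Order.disp_t} {P : porderType d}.
Local Open Scope order_scope.
Implicit Types (U V : P -> Prop) (p q x y : P).

Lemma scott_open_cap U V : ScottOpen U -> ScottOpen V -> ScottOpen (capS U V).
Proof.
move=> [upU dU] [upV dV]; split=> [x y [Ux Vx] xy|D s hD hs [Us Vs]].
  by split; [apply: upU xy|apply: upV xy].
have [e De Ue] := dU _ _ hD hs Us; have [e' De' Ve'] := dV _ _ hD hs Vs.
have [c [Dc ec ec']] := hD.2 _ _ De De'.
by exists c => //; split; [apply: upU ec|apply: upV ec'].
Qed.

(** The image of a directed set is directed and its supremum is the image of the supremum. Scott
    continuity of translations enters the argument only through this lemma. *)
Lemma scott_open_preimage (T : P -> P) U :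
  ScottContinuous T -> ScottOpen U -> ScottOpen (fun x => U (T x)).
Proof.
move=> [mT cT] [upU dU]; split=> [x y Ux xy|D s hD hs Us].
  by apply: upU Ux _; apply: mT.
have [|y [e De ->] Ue] := dU _ _ _ (cT _ _ hD hs) Us; last by exists e.
split=> [|_ _ [a Da ->] [b Db ->]].
  by case: hD.1 => x Dx; exists (T x), x.
have [c [Dc ac bc]] := hD.2 _ _ Da Db.
by exists (T c); split; [exists c|apply: mT|apply: mT].
Qed.

Lemma scott_int_open U : ScottOpen (ScottInt U).
Proof.
split=> [x y [V [oV VU Vx]] xy|D s hD hs [V [oV VU Vs]]].
  by exists V; split=> //; apply: oV.1 xy.
by have [e De Ve] := oV.2 _ _ hD hs Vs; exists e => //; exists V.
Qed.

Lemma scott_int_Up p x : ScottInt (Up p) x -> p <= x.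
Proof. by case=> V [_ VU Vx]; apply: VU. Qed.

Lemma subs_scott_int_Up U p : ScottOpen U -> U p -> subs (ScottInt (Up p)) U.
Proof. by move=> oU Up x /scott_int_Up; apply: oU.1. Qed.

Lemma subs_scott_int_UpS p q :
  p <= q -> subs (ScottInt (Up q)) (ScottInt (Up p)).
Proof.
move=> pq x [V [oV VU Vx]]; exists V; split=> // y Vy.
exact: le_trans pq (VU _ Vy).
Qed.

(** Test the definition on the directed set whose only element is [y]. *)
Lemma way_below_le x y : way_below x y -> x <= y.
Proof.
move=> /(_ (fun z => z = y) y) [| | |e -> //]; last exact: lexx.
  by split=> [|a b -> ->]; exists y.
by split=> [x0 ->|u]; [exact: lexx|apply].
Qed.

Lemma way_below_trl x y z : x <= y -> way_below y z -> way_below x z.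
Proof.
move=> xy yz D s hD hs zs; have [e De ye] := yz D s hD hs zs.
by exists e => //; apply: le_trans xy ye.
Qed.

Lemma way_below_trr x y z : way_below x y -> y <= z -> way_below x z.
Proof. by move=> xy yz D s hD hs zs; apply: (xy D s) => //; apply: le_trans zs. Qed.

Hypothesis hP : ContinuousPoset (P := P).

(** The points two way-below steps under [s] still form a directed set with supremum [s]; hence [x]
    lies under one of them, and the intermediate point of that one interpolates. *)
Lemma way_below_interpolation x s :
  way_below x s -> exists2 y, way_below x y & way_below y s.
Proof.
pose E z := exists2 y, way_below z y & way_below y s.
have [[[y0 y0s] dirs] sups] := hP s.
have dirE : Directed E.
  split; first by case: (hP y0).1.1 => z zy0; exists z, y0.
  move=> z1 z2 [y1 z1y1 y1s] [y2 z2y2 y2s].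
  have [y3 [y3s le1 le2]] := dirs _ _ y1s y2s.
  (* Both points are now way below the common [y3], and the points way below [y3] are directed. *)
  have [z3 [z3y3 le1' le2']] :=
    (hP y3).1.2 _ _ (way_below_trr z1y1 le1) (way_below_trr z2y2 le2).
  by exists z3; split=> //; exists y3.
have supE : IsSup E s.
  split=> [z [y zy ys]|u uE]; first exact: le_trans (way_below_le zy) (way_below_le ys).
  apply: sups.2 => y ys; apply: (hP y).2.2 => z zy; apply: uE.
  by exists y.
move=> /(_ _ _ dirE supE (lexx s)) [z [y zy ys] xz].
by exists y => //; apply: way_below_trl xz zy.
Qed.

(** Interpolate [y] between [x] and the supremum: the directed set has an element above [y], and
    that element is way above [x]. *)
Lemma scott_open_way_above x : ScottOpen (fun y => way_below x y).
Proof.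
split=> [y z xy yz|D s hD hs /way_below_interpolation [y xy ys]].
  exact: way_below_trr yz.
by have [e De ye] := ys _ _ hD hs (lexx s); exists e => //; apply: way_below_trr ye.
Qed.

(** Together with TR2 this puts [T e p] in the interior of the up-set of [p] for [e > 0]. *)
Lemma way_below_scott_int p x : way_below p x -> ScottInt (Up p) x.
Proof.
move=> px; exists (fun y => way_below p y); split=> //.
  exact: scott_open_way_above.
by move=> y /way_below_le.
Qed.

Lemma scott_open_approx U p : ScottOpen U -> U p -> exists2 x, U x & way_below x p.
Proof.
move=> oU Up; have [dirp supp] := hP p.
by have [x xp Ux] := oU.2 _ _ dirp supp Up; exists x.
Qed.

End ScottTopology.

(** * Presheaves on the Scott topology and their stalks *)

Section Presheaves.
Context {k : comPzRingType} {d : Order.disp_t} {P : porderType d}.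
Local Open Scope order_scope.
Implicit Types (F G : Sheaf k P) (U V W : P -> Prop) (p q : P).

Local Notation rs F U V := (@Defs.res _ _ _ F U V).

Record IsPresheaf F : Prop := {
  psh_cong : forall U, ScottOpen U -> IsCong (sec F U);
  psh_lin : forall U V, ScottOpen U -> ScottOpen V -> subs V U -> IsLin (rs F U V);
  psh_id : forall U, ScottOpen U -> forall s, mdom s -> meq (rs F U U s) s;
  psh_comp : forall U V W, ScottOpen U -> ScottOpen V -> ScottOpen W ->
     subs V U -> subs W V -> forall s, mdom s ->
     meq (rs F V W (rs F U V s)) (rs F U W s) }.

Lemma IsSheaf_presheaf F : IsSheaf F -> IsPresheaf F.
Proof. by case=> hM *; split=> // U oU; apply/IsMod_cong/hM. Qed.

Section Stalks.
Variable F : Sheaf k P.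
Hypothesis hF : IsPresheaf F.

Lemma psh_meq U V s t : ScottOpen U -> ScottOpen V -> subs V U ->
  meq s t -> meq (rs F U V s) (rs F U V t).
Proof. by move=> oU oV VU; apply: lin_meq; apply: psh_lin. Qed.

Lemma psh_trans U (s t u : car (sec F U)) :
  ScottOpen U -> meq s t -> meq t u -> meq s u.
Proof. by move=> oU; apply: cong_trans; apply: psh_cong. Qed.

Lemma psh_sym U (s t : car (sec F U)) : ScottOpen U -> meq s t -> meq t s.
Proof. by move=> oU; apply: cong_sym; apply: psh_cong. Qed.

Lemma psh_meq_shrink U V W W' (s : car (sec F U)) (t : car (sec F V)) :
  ScottOpen U -> ScottOpen V -> ScottOpen W -> ScottOpen W' ->
  subs W U -> subs W V -> subs W' W -> mdom s -> mdom t ->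
  meq (rs F U W s) (rs F V W t) -> meq (rs F U W' s) (rs F V W' t).
Proof.
move=> oU oV oW oW' WU WV W'W ds dt e.
apply: (psh_trans oW' (psh_sym oW' (psh_comp hF oU oW oW' WU W'W ds))).
apply: (psh_trans oW' (psh_meq oW oW' W'W e)).
exact: (psh_comp hF).
Qed.

Lemma stalk_sym p (a b : car (stalk F p)) : meq a b -> meq b a.
Proof.
move=> [[oa ap] da [ob bp] db [W [oW Wp Wa Wb e]]]; split=> //.
by exists W; split=> //; apply: psh_sym.
Qed.

Lemma stalk_trans p (a b c : car (stalk F p)) : meq a b -> meq b c -> meq a c.
Proof.
move=> [[oa ap] da [ob bp] db [W [oW Wp Wa Wb e]]].
move=> [_ _ [oc cp] dc [W' [oW' Wp' W'b W'c e']]]; split=> //.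
have oC := scott_open_cap oW oW'.
have CW : subs (capS W W') W by move=> x [].
have CW' : subs (capS W W') W' by move=> x [].
exists (capS W W'); split=> //.
- by move=> x /CW /Wa.
- by move=> x /CW' /W'c.
- apply: (psh_trans oC (psh_meq_shrink _ _ oW oC Wa Wb CW da db e)) => //.
  exact: (psh_meq_shrink _ _ oW' oC W'b W'c CW' db dc e').
Qed.

Lemma stalk_dom p U (s : car (sec F U)) :
  ScottOpen U -> U p -> mdom s -> mdom (existT _ U s : car (stalk F p)).
Proof.
move=> oU Up ds; split=> //; exists U; split=> //.
by apply: psh_meq.
Qed.

Lemma stalk_res p U W (s : car (sec F U)) :
  ScottOpen U -> ScottOpen W -> subs W U -> W p -> mdom s ->
  meq (existT _ U s : car (stalk F p)) (existT _ W (rs F U W s)).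
Proof.
move=> oU oW WU Wp ds; split=> //; first by split=> //; apply: WU.
  by apply: psh_meq.
exists W; split=> //=; apply: (psh_sym oW).
by apply: (psh_id hF oW); apply: psh_meq.
Qed.

Lemma stalk_meq p U (s t : car (sec F U)) :
  ScottOpen U -> U p -> meq s t ->
  meq (existT _ U s : car (stalk F p)) (existT _ U t).
Proof.
move=> oU Up st; have cU := psh_cong hF oU.
split=> //; [exact: cong_doml st|exact: cong_domr st|].
by exists U; split=> //; apply: psh_meq.
Qed.

(** Open sets are up-sets, so a neighbourhood of [p] is one of [q]. This is why [jstar] can use the
    identity on representatives as structure map. *)
Lemma stalk_mono p q (a b : car (stalk F p)) :
  p <= q -> meq a b -> meq (a : car (stalk F q)) b.
Proof.
move=> pq [[oa ap] da [ob bp] db [W [oW Wp Wa Wb e]]].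
split=> //; [by split=> //; apply: oa.1 pq|by split=> //; apply: ob.1 pq|].
by exists W; split=> //; apply: oW.1 pq.
Qed.

Lemma capSl U V : subs (capS U V) U. Proof. by move=> x []. Qed.
Lemma capSr U V : subs (capS U V) V. Proof. by move=> x []. Qed.

Lemma psh_madd_res U W (s t : car (sec F U)) : ScottOpen U -> ScottOpen W ->
  subs W U -> mdom s -> mdom t ->
  meq (rs F U W (madd s t)) (madd (rs F U W s) (rs F U W t)).
Proof. by move=> oU oW WU ds dt; case: (psh_lin hF oU oW WU) => _ + _; apply. Qed.

Lemma stalk_cong p : IsCong (stalk F p).
Proof.
split; [exact: stalk_sym|exact: stalk_trans| |].
- move=> [A a] [A' a'] [B b] [B' b'].
  move=> [[/= oA Ap] da [oA' A'p] da' [W [oW Wp WA WA' ea]]].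
  move=> [[/= oB Bp] db [oB' B'p] db' [Z [oZ Zp ZB ZB' eb]]].
  have oAB := scott_open_cap oA oB; have oAB' := scott_open_cap oA' oB'.
  have oWZ := scott_open_cap oW oZ.
  have mono U V U' V' : subs U' U -> subs V' V -> subs (capS U' V') (capS U V).
    by move=> h h' x [? ?]; split; auto.
  have dom U V s : ScottOpen U -> ScottOpen V -> subs V U -> mdom s ->
    mdom (rs F U V s) by move=> oU oV VU; apply: psh_meq.
  (* A sum of germs lives on the overlap of the two domains. Restricted to a smaller open set it is
     the sum of the restrictions, so the two sums can be compared on [capS W Z]. *)
  have addE U V X s t : ScottOpen U -> ScottOpen V -> ScottOpen X ->
      subs X (capS U V) -> mdom s -> mdom t ->
      meq (rs F (capS U V) X (madd (rs F U (capS U V) s) (rs F V (capS U V) t)))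
          (madd (rs F U X s) (rs F V X t)).
    move=> oU oV oX hX ds dt; have oUV := scott_open_cap oU oV.
    have [UVU UVV] := (@capSl U V, @capSr U V).
    case: (psh_lin hF oUV oX hX) => _ lin _.
    apply: (psh_trans oX (lin _ _ (dom _ _ _ oU oUV UVU ds) (dom _ _ _ oV oUV UVV dt))).
    by apply: (cong_add (psh_cong hF oX)); apply: (psh_comp hF).
  split=> //=.
  + apply: (cong_add (psh_cong hF oAB)); apply: psh_meq => //.
    exact: capSl.
    exact: capSr.
  + apply: (cong_add (psh_cong hF oAB')); apply: psh_meq => //.
    exact: capSl.
    exact: capSr.
  have [WZA WZA'] := (mono _ _ _ _ WA ZB, mono _ _ _ _ WA' ZB').
  exists (capS W Z); split=> //.
  apply: (psh_trans oWZ (addE _ _ _ _ _ oA oB oWZ WZA da db)).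
  apply: (psh_trans oWZ _ (psh_sym oWZ (addE _ _ _ _ _ oA' oB' oWZ WZA' da' db'))).
  apply: (cong_add (psh_cong hF oWZ)).
    exact: (psh_meq_shrink oA oA' oW oWZ WA WA' (@capSl W Z) da da' ea).
  exact: (psh_meq_shrink oB oB' oZ oWZ ZB ZB' (@capSr W Z) db db' eb).
- move=> c [A a] [A' a'] [[/= oA Ap] da [oA' A'p] da' [W [oW Wp WA WA' ea]]].
  split=> //=; first exact: (cong_scale (psh_cong hF oA)).
    exact: (cong_scale (psh_cong hF oA')).
  exists W; split=> //.
  case: (psh_lin hF oA oW WA) => _ _ lA; case: (psh_lin hF oA' oW WA') => _ _ lA'.
  apply: (psh_trans oW (lA _ _ da)).
  apply: (psh_trans oW _ (psh_sym oW (lA' _ _ da'))).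
  exact: (cong_scale (psh_cong hF oW)).
Qed.

Lemma jstar_pre : IsPrePMod (jstar F).
Proof.
split.
- exact: stalk_cong.
- move=> p q pq; split=> [x y|x y dx dy|a x dx]; first exact: stalk_mono.
    by apply: (cong_add (stalk_cong q)); apply: stalk_mono pq _.
  by apply: (cong_scale (stalk_cong q)); apply: stalk_mono pq _.
- by [].
- move=> p q r pq qr x dx; exact: (stalk_mono (le_trans pq qr) dx).
Qed.

Lemma jshriek_pre : IsPrePMod (jshriek F).
Proof.
split=> [p|p q pq|p x dx|p q r pq qr x dx].
- exact/(psh_cong hF)/scott_int_open.
- apply: (psh_lin hF); [exact: scott_int_open..|exact: subs_scott_int_UpS].
- by apply: (psh_id hF) => //; apply: scott_int_open.
- by apply: (psh_comp hF) => //; (apply: scott_int_open || apply: subs_scott_int_UpS).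
Qed.

End Stalks.
End Presheaves.

(** * The inverse image of a sheaf along a translation *)

Section InverseImage.
Context {k : comPzRingType} {d : Order.disp_t} {P : porderType d}.
Local Open Scope order_scope.
Implicit Types (F G : Sheaf k P) (U V W : P -> Prop) (p q : P).
Variable T : P -> P.

(** Convertible with the condition local to the definition of [pull_sh]; naming it lets statements
    refer to it. *)
Definition locally_induced F U (s : forall p, car (stalk F (T p))) : Prop :=
  forall p, U p -> exists W, [/\ ScottOpen W, W p, subs W U &
    exists V (sg : car (sec F V)),
      [/\ ScottOpen V, (forall q, W q -> V (T q)), mdom sg &
          forall q, W q -> meq (s q) (existT _ V sg : car (stalk F (T q)))]].

Lemma locally_induced_eq F U (s t : forall p, car (stalk F (T p))) :
  IsPresheaf F -> locally_induced U t -> (forall p, U p -> meq (s p) (t p)) ->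
  locally_induced U s.
Proof.
move=> hF lt st p Up; have [W [oW Wp WU [V [sg [oV WV dsg e]]]]] := lt p Up.
exists W; split=> //; exists V, sg; split=> // q Wq.
by apply: (stalk_trans hF (st q (WU q Wq))); apply: e.
Qed.

Lemma locally_induced_sub F U V (s : forall p, car (stalk F (T p))) :
  ScottOpen V -> subs V U -> locally_induced U s -> locally_induced V s.
Proof.
move=> oV VU ls p Vp; have [W [oW Wp WU [A [sg [oA WA dsg e]]]]] := ls p (VU p Vp).
exists (capS W V); split=> //; [exact: scott_open_cap|by move=> x []|].
by exists A, sg; split=> // q [Wq _]; [apply: WA|apply: e].
Qed.

Lemma pull_meq F U (s t : car (sec (pull_sh T F) U)) : IsPresheaf F ->
  locally_induced U t -> (forall p, U p -> meq (s p) (t p)) -> meq s t.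
Proof. by move=> hF lt st; split=> //; apply: locally_induced_eq lt st. Qed.

(** Restriction leaves a family of germs unchanged and only shrinks the set where equality is
    tested, so functoriality is immediate. The content is that locally induced families are closed
    under sums and scalings. *)
Lemma pull_presheaf F : IsPresheaf F -> IsPresheaf (pull_sh T F).
Proof.
move=> hF.
have sub U V (s t : forall p, car (stalk F (T p))) : ScottOpen V -> subs V U ->
    @meq _ (sec (pull_sh T F) U) s t -> @meq _ (sec (pull_sh T F) V) s t.
  move=> oV VU [ls lt st]; split; [exact: locally_induced_sub ls|
    exact: locally_induced_sub lt|by move=> p /VU /st].
have cong U : ScottOpen U -> IsCong (sec (pull_sh T F) U).
  move=> oU; split.
  - by move=> s t [ls lt st]; split=> // p Up; apply: (stalk_sym hF); apply: st.
  - move=> s t u [ls lt st] [_ lu tu]; split=> // p Up.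
    exact: (stalk_trans hF (st p Up) (tu p Up)).
  - have add s t : locally_induced (F := F) U s -> locally_induced U t ->
        locally_induced U (fun p => madd (s p) (t p)).
      move=> ls lt p Up.
      have [W [oW Wp WU [A [a [oA WA da sa]]]]] := ls p Up.
      have [Z [oZ Zp ZU [B [b [oB ZB db tb]]]]] := lt p Up.
      have oAB := scott_open_cap oA oB.
      exists (capS W Z); split=> //; [exact: scott_open_cap|by move=> x [/WU]|].
      exists (capS A B), (madd (Defs.res (capS A B) a) (Defs.res (capS A B) b)).
      split=> //.
      + by move=> q [/WA ? /ZB ?]; split.
      + apply: (cong_add (psh_cong hF oAB)); apply: (psh_meq hF) => //.
        exact: capSl.
        exact: capSr.
      + move=> q [Wq Zq].
        exact: (cong_add (stalk_cong hF (T q)) (sa q Wq) (tb q Zq)).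
    move=> s s' t t' [ls ls' ss'] [lt lt' tt']; split; [exact: add|exact: add|].
    move=> p Up; apply: (cong_add (stalk_cong hF (T p))); [exact: ss'|exact: tt'].
  - have scale c s : locally_induced (F := F) U s ->
        locally_induced U (fun p => mscale c (s p)).
      move=> ls p Up; have [W [oW Wp WU [A [a [oA WA da sa]]]]] := ls p Up.
      exists W; split=> //; exists A, (mscale c a); split=> //.
        exact: (cong_scale (psh_cong hF oA)).
      by move=> q Wq; apply: (cong_scale (stalk_cong hF (T q)) _ (sa q Wq)).
    move=> c s s' [ls ls' ss']; split; [exact: scale|exact: scale|].
    by move=> p Up; apply: (cong_scale (stalk_cong hF (T p))); apply: ss'.
split=> //.
- move=> U V oU oV VU; split=> [s t|s t ds dt|c s ds].
  + exact: sub.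
  + by apply: (cong_add (cong V oV)); apply: sub VU _.
  + by apply: (cong_scale (cong V oV)); apply: sub VU _.
- move=> U V W oU oV oW VU WV s ds; apply: (sub U) => // x /WV; exact: VU.
Qed.

(** The injective half of the identification of the stalk of the inverse image at [p] with the stalk
    of [F] at [T p]. Sections of [F] inducing [s] and [t] near [p] agree on a neighbourhood [Q] of
    [T p]; by Scott continuity the preimage of [Q] is a neighbourhood of [p], and there [s] and [t]
    agree. *)
Lemma pull_stalk_inj F p U V
    (s : car (sec (pull_sh T F) U)) (t : car (sec (pull_sh T F) V)) :
  IsPresheaf F -> ScottContinuous T -> ScottOpen U -> ScottOpen V -> U p -> V p ->
  mdom s -> mdom t -> meq (s p) (t p) ->
  meq (existT _ U s : car (stalk (pull_sh T F) p)) (existT _ V t).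
Proof.
move=> hF cT oU oV Up Vp ds dt st.
split=> //; have [[ls _ _] [lt _ _]] := (ds, dt).
have [W [oW Wp WU [A [a [oA WA da sa]]]]] := ls p Up.
have [Z [oZ Zp ZV [B [b [oB ZB db tb]]]]] := lt p Vp.
have [_ _ _ _ [Q [oQ Qp QA QB qe]]] := stalk_trans hF
  (stalk_sym hF (sa p Wp)) (stalk_trans hF st (tb p Zp)).
have oWZ := scott_open_cap oW oZ.
have oTQ := scott_open_preimage cT oQ.
have oN := scott_open_cap oWZ oTQ.
have NU : subs (capS (capS W Z) (fun x => Q (T x))) U by move=> x [[/WU]].
have NV : subs (capS (capS W Z) (fun x => Q (T x))) V by move=> x [[_ /ZV]].
exists (capS (capS W Z) (fun x => Q (T x))); split=> //.
apply: pull_meq => //; first exact: locally_induced_sub lt.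
move=> q [[Wq Zq] Qq]; apply: (stalk_trans hF (sa q Wq)).
apply: (stalk_trans hF _ (stalk_sym hF (tb q Zq))).
split=> //; [by split=> //; apply: WA|by split=> //; apply: ZB|by exists Q].
Qed.

Lemma nat_sh_locally_induced F U (s : car (sec F U)) : IsPresheaf F ->
  Translation T -> ScottOpen U -> mdom s -> locally_induced U (nat_sh T s).
Proof.
move=> hF [_ iT] oU ds p Up; exists U; split=> //; exists U, s.
have UT q : U q -> U (T q) by move=> Uq; apply: oU.1 (iT q).
by split=> // q Uq; apply: (stalk_dom hF oU (UT q Uq) ds).
Qed.

Lemma nat_sh_dom F U (s : car (sec F U)) : IsPresheaf F ->
  Translation T -> ScottOpen U -> mdom s -> mdom (nat_sh T s).
Proof.
move=> hF [mT iT] oU ds; apply: pull_meq => //; first exact: nat_sh_locally_induced.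
by move=> p Up; apply: (stalk_dom hF) => //; apply: oU.1 (iT p).
Qed.

End InverseImage.

(** * Interleavings of sheaves and of their stalk modules *)

Section SheafInterleavings.
Context {k : comPzRingType} {d : Order.disp_t} {P : porderType d}.
Local Open Scope order_scope.
Implicit Types (F G : Sheaf k P) (U V W : P -> Prop) (p q : P).
Variable T : P -> P.

(** The value at [p] of the image of a representative depends only on the germ, because [f] commutes
    with restriction ([fres]). *)
Lemma shmor_pmor F G (f : forall U, car (sec F U) -> car (sec (pull_sh T G) U)) :
  IsPresheaf F -> IsPresheaf G -> IsShMor f ->
  Translation T ->
  IsPMor (M := jstar F) (N := pull_pm T (jstar G))
    (fun p a => f (projT1 a) (projT2 a) p).
Proof.
move=> hF hG [lf nf] [mT _].
have fres U W s p : ScottOpen U -> ScottOpen W -> subs W U -> W p -> mdom s ->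
    meq (f U s p) (f W (@Defs.res _ _ _ F U W s) p).
  by move=> oU oW WU Wp ds; have [_ _] := nf U W oU oW WU s ds; apply.
split=> [p|p q pq [U s] [[oU Up] ds _ _ _]]; last first.
  (* Near [p] the image is induced by a single section of [G]. The neighbourhood [W] is an up-set,
     so the same section represents the germ at [q]. *)
  have [ls _ _] := lin_meq (lf U oU) ds.
  have [W [oW Wp WU [V [sg [oV WV dsg e]]]]] := ls p Up.
  have Wq : W q by apply: oW.1 pq.
  apply: (stalk_trans hG (stalk_mono (mT _ _ pq) (e p Wp))).
  exact: (stalk_sym hG (e q Wq)).
split.
- move=> [A a] [B b] [[/= oA Ap] da [oB Bp] db [W [oW Wp WA WB e]]].
  apply: (stalk_trans hG (fres _ _ _ _ oA oW WA Wp da)).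
  apply: (stalk_trans hG _ (stalk_sym hG (fres _ _ _ _ oB oW WB Wp db))).
  by have [_ _] := lin_meq (lf W oW) e; apply.
- move=> [A a] [B b] [[/= oA Ap] da _ _ _] [[/= oB Bp] db _ _ _].
  have oAB := scott_open_cap oA oB.
  have da' := psh_meq hF oA oAB (@capSl _ _ A B) da.
  have db' := psh_meq hF oB oAB (@capSr _ _ A B) db.
  have [_ lin _] := lf _ oAB.
  have [_ _ /(_ p (conj Ap Bp)) e] := lin _ _ da' db'.
  have ea := stalk_sym hG (fres _ _ _ _ oA oAB (@capSl _ _ A B) (conj Ap Bp) da).
  have eb := stalk_sym hG (fres _ _ _ _ oB oAB (@capSr _ _ A B) (conj Ap Bp) db).
  exact: (stalk_trans hG e (cong_add (stalk_cong hG (T p)) ea eb)).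
- move=> c [A a] [[/= oA Ap] da _ _ _].
  have [_ _ lin] := lf _ oA.
  by have [_ _] := lin c _ da; apply.
Qed.

(** Evaluate the sheaf identity twice. At [p] it is an equality of germs of sections of the inverse
    image, valid on a neighbourhood of [T p]; evaluating there at [T p] gives the identity of
    stalks. *)
Lemma sh_interleaving_stalk F G
    (f : forall U, car (sec F U) -> car (sec (pull_sh T G) U))
    (g : forall U, car (sec G U) -> car (sec (pull_sh T F) U)) :
  (forall U, ScottOpen U -> forall s, mdom s ->
     meq (pull_mor g (f U s)) (nat_sh T (nat_sh T s))) ->
  forall p (a : car (stalk F p)), mdom a ->
  meq (g _ (projT2 (f _ (projT2 a) p)) (T p) : car (stalk F (T (T p)))) a.
Proof.
move=> gf p [U s] [[/= oU Up] ds _ _ _].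
have [_ _ /(_ p Up) [_ _ _ _ [W [oW Wp _ _ [_ _ e]]]]] := gf U oU s ds.
exact: e.
Qed.

Section FromStalks.
Hypothesis hP : ContinuousPoset (P := P).

Definition sections_of_stalks F G
    (phi : forall p, car (stalk F p) -> car (stalk G (T p))) U (s : car (sec F U)) :
  car (sec (pull_sh T G) U) := fun p => phi p (existT _ U s).

Section Mor.
Variables (F G : Sheaf k P).
Variable phi : forall p, car (stalk F p) -> car (stalk G (T p)).
Arguments phi : clear implicits.
Hypothesis hF : IsPresheaf F.
Hypothesis hG : IsPresheaf G.
Hypothesis trT : Translation T.
Hypothesis hphi : IsPMor (M := jstar F) (N := pull_pm T (jstar G)) phi.

(* By continuity of P some x << p lies in U; a germ of a section of G
   representing the image of s at x then represents it on the whole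
   neighbourhood of p formed by the points way above x. *)
Lemma sections_of_stalks_locally_induced U (s : car (sec F U)) :
  ScottOpen U -> mdom s -> locally_induced U (sections_of_stalks phi s).
Proof.
move=> oU ds p Up; have [x Ux xp] := scott_open_approx hP oU Up.
exists (fun y => way_below x y); split=> //; first exact: scott_open_way_above.
  by move=> y /way_below_le; apply: oU.1.
have dphi : mdom (phi x (existT _ U s)).
  by apply: (mor_meq hphi); apply: stalk_dom.
have [[oV Vx] dsg _ _ _] := dphi.
exists (projT1 (phi x (existT _ U s))), (projT2 (phi x (existT _ U s))); split=> //.
- by move=> q /way_below_le xq; apply: oV.1 Vx _; apply: trT.1.
- move=> q /way_below_le xq.
  have := hphi.2 _ _ xq _ (stalk_dom hF oU Ux ds); rewrite /sections_of_stalks /=.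
  by case: (phi x _) => V sg /(stalk_sym hG).
Qed.

(** Equality of sections of the inverse image is pointwise once they are known to be locally
    induced, so each law reduces to the one for [phi] on stalks. *)
Lemma sections_of_stalks_shmor : IsShMor (sections_of_stalks phi).
Proof.
have eqU U (s : car (sec F U)) (t : car (sec (pull_sh T G) U)) :
    ScottOpen U -> mdom s ->
    (forall p, U p -> meq (sections_of_stalks phi s p) (t p)) ->
    meq (sections_of_stalks phi s) t.
  move=> oU ds e; apply: (cong_sym (psh_cong (pull_presheaf T hG) oU)).
  apply: pull_meq => //; first exact: sections_of_stalks_locally_induced.
  by move=> p Up; apply: (stalk_sym hG); apply: e.
split=> [U oU|U V oU oV VU s ds].
- have [cU cF] := (psh_cong hF oU, fun p => pre_cong (jstar_pre hF) p).
  split=> [s t st|s t ds dt|c s ds]; apply: eqU => //.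
  + exact: cong_doml st.
  + by move=> p Up; apply: (mor_meq hphi); apply: stalk_meq.
  + exact: (cong_add cU).
  + move=> p Up; have [_ lin _] := hphi.1 p.
    apply: (stalk_trans hG _ (lin _ _ (stalk_dom hF oU Up ds) (stalk_dom hF oU Up dt))).
    apply: (mor_meq hphi).
    (* The sum of two germs given on [U] is represented on [capS U U], a different index from [U];
       the germ of [madd s t] is restricted there before comparing. *)
    have oUU := scott_open_cap oU oU.
    have UUU : subs (capS U U) U by move=> x [].
    apply: (stalk_trans hF (stalk_res hF oU oUU UUU (conj Up Up) (cong_add cU ds dt))).
    by apply: (stalk_meq hF) => //; apply: psh_madd_res.
  + exact: (cong_scale cU).
  + move=> p Up; have [_ _ lin] := hphi.1 p.
    exact: (lin c _ (stalk_dom hF oU Up ds)).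
- apply: (cong_sym (psh_cong (pull_presheaf T hG) oV)).
  apply: eqU => //; first exact: (psh_meq hF).
  move=> p Vp; apply: (mor_meq hphi); apply: (stalk_sym hF).
  exact: stalk_res.
Qed.

End Mor.

Lemma stalk_interleaving_sh F G
    (phi : forall p, car (stalk F p) -> car (stalk G (T p)))
    (gam : forall p, car (stalk G p) -> car (stalk F (T p))) :
  IsPresheaf F -> IsPresheaf G -> Translation T -> ScottContinuous T ->
  IsPMor (M := jstar F) (N := pull_pm T (jstar G)) phi ->
  IsPMor (M := jstar G) (N := pull_pm T (jstar F)) gam ->
  (forall p (a : car (stalk F p)), mdom a ->
     meq (gam (T p) (phi p a)) (a : car (stalk F (T (T p))))) ->
  forall U, ScottOpen U -> forall s : car (sec F U), mdom s ->
    meq (pull_mor (sections_of_stalks gam) (sections_of_stalks phi s))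
        (nat_sh T (nat_sh T s)).
Proof.
move=> hF hG trT cT hphi hgam gp U oU s ds; have [mT iT] := trT.
have hTF := pull_presheaf T hF.
have dn := nat_sh_dom hF trT oU ds.
apply: (pull_meq hTF); first exact: nat_sh_locally_induced.
move=> p Up; have dphi : mdom (phi p (existT _ U s)).
  by apply: (mor_meq hphi); apply: stalk_dom.
rewrite /pull_mor /nat_sh /sections_of_stalks /germ_map.
have := gp p (existT _ U s) (stalk_dom hF oU Up ds).
move: dphi; case: (phi p _) => V t [[oV Vp] dt _ _ _] e.
(* Both sides at [p] are germs at [T p] of sections of the inverse image, so it suffices that their
   values at [T p] agree, which is the stalk identity [e]. *)
apply: (@pull_stalk_inj _ _ _ T F (T p) V U) => //; first exact: oU.1 (iT p).
by have [/(_ V oV) lin _] := sections_of_stalks_shmor hG hF trT hgam; apply: (lin_meq lin).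
Qed.

End FromStalks.

Lemma sh_interleaved_stalks F G : ContinuousPoset (P := P) ->
  IsPresheaf F -> IsPresheaf G -> Translation T -> ScottContinuous T ->
  sh_interleaved T F G <-> pm_interleaved T (jstar F) (jstar G).
Proof.
move=> hP hF hG trT cT; split=> [[f [g [hf hg gf fg]]]|[phi [gam [hphi hgam gp pg]]]].
- exists (fun p a => f (projT1 a) (projT2 a) p).
  exists (fun p a => g (projT1 a) (projT2 a) p).
  split; [exact: shmor_pmor|exact: shmor_pmor| |].
    exact: (sh_interleaving_stalk gf).
  exact: (sh_interleaving_stalk fg).
- exists (sections_of_stalks phi), (sections_of_stalks gam).
  split; [exact: sections_of_stalks_shmor|exact: sections_of_stalks_shmor| |].
    exact: (stalk_interleaving_sh hP hF hG trT cT hphi hgam gp).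
  exact: (stalk_interleaving_sh hP hG hF trT cT hgam hphi pg).
Qed.

End SheafInterleavings.

(** * Limits over up-sets: the lower module and the sheaf of compatible families *)

Section Limits.
Context {k : comPzRingType} {d : Order.disp_t} {P : porderType d}.
Local Open Scope order_scope.
Variable M : PMod k P.
Hypothesis hM : IsPrePMod M.
Implicit Types (D E : P -> Prop) (p q x y : P).

Definition compatible D (f : forall x, car (pm M x)) : Prop :=
  (forall x, D x -> mdom (f x)) /\
  (forall x y, D x -> D y -> x <= y -> meq (M $[x --> y] (f x)) (f y)).

Lemma lim_cong D : IsCong (limMod M D).
Proof.
have cM x := pre_cong hM x.
have add f g : compatible D f -> compatible D g ->
    compatible D (fun x => madd (f x) (g x)).
  move=> [df cf] [dg cg]; split=> [x Dx|x y Dx Dy xy].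
    by apply: (cong_add (cM x)); [apply: df|apply: dg].
  have [_ lin _] := pre_lin hM xy.
  apply: (cong_trans (cM y) (lin _ _ (df x Dx) (dg x Dx))).
  by apply: (cong_add (cM y)); [apply: cf|apply: cg].
have scale a f : compatible D f -> compatible D (fun x => mscale a (f x)).
  move=> [df cf]; split=> [x Dx|x y Dx Dy xy].
    by apply: (cong_scale (cM x)); apply: df.
  have [_ _ lin] := pre_lin hM xy.
  apply: (cong_trans (cM y) (lin a _ (df x Dx))).
  by apply: (cong_scale (cM y)); apply: cf.
split.
- by move=> f g [cf cg e]; split=> // x Dx; apply: (cong_sym (cM x)); apply: e.
- move=> f g h [cf cg e] [_ ch e']; split=> // x Dx.
  exact: (cong_trans (cM x) (e x Dx) (e' x Dx)).
- move=> f f' g g' [cf cf' ef] [cg cg' eg]; split; [exact: add|exact: add|].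
  by move=> x Dx; apply: (cong_add (cM x)); [apply: ef|apply: eg].
- move=> a f f' [cf cf' ef]; split; [exact: scale|exact: scale|].
  by move=> x Dx; apply: (cong_scale (cM x)); apply: ef.
Qed.

Lemma lim_meq_sub D E (f g : forall x, car (pm M x)) : (forall x, E x -> D x) ->
  @meq _ (limMod M D) f g -> @meq _ (limMod M E) f g.
Proof.
move=> ED [[df cf] [dg cg] e].
by split=> [||x /ED]; [split=> [x /ED|x y /ED Dx /ED Dy]|
  split=> [x /ED|x y /ED Dx /ED Dy]|]; auto.
Qed.

Lemma lim_res_lin D E : (forall x, E x -> D x) ->
  IsLin (M := limMod M D) (N := limMod M E) (fun f => f).
Proof.
move=> ED; split=> [f g|f g df dg|a f df].
- exact: lim_meq_sub.
- by apply: (cong_add (lim_cong E)); apply: lim_meq_sub ED _.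
- by apply: (cong_scale (lim_cong E)); apply: lim_meq_sub ED _.
Qed.

Lemma lim_eval_lin D x : D x ->
  IsLin (M := limMod M D) (N := pm M x) (fun f => f x).
Proof.
move=> Dx; split=> [f g [_ _]|f g [[df _] _ _] [[dg _] _ _]|a f [[df _] _ _]].
- exact.
- by apply: (cong_add (pre_cong hM x)); [apply: df|apply: dg].
- by apply: (cong_scale (pre_cong hM x)); apply: df.
Qed.

(** Total in [x] because elements of [limMod] are; only the values at points above [p] carry
    meaning. *)
Definition cone p (m : car (pm M p)) : forall x, car (pm M x) :=
  fun x => M $[p --> x] m.

Lemma cone_compatible D p (m : car (pm M p)) :
  (forall x, D x -> p <= x) -> mdom m -> compatible D (cone m).
Proof.
move=> pD dm; split=> [x /pD px|x y /pD px Dy xy]; first exact: pre_meq.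
exact: pre_comp.
Qed.

Lemma cone_lin D p : (forall x, D x -> p <= x) ->
  IsLin (M := pm M p) (N := limMod M D) (@cone p).
Proof.
move=> pD; have cM := pre_cong hM.
(* A family that agrees with a cone on [D] inherits its compatibility, so linearity can be checked
   pointwise. *)
have eqD (m : car (pm M p)) (f : forall x, car (pm M x)) : mdom m ->
    (forall x, D x -> meq (cone m x) (f x)) -> @meq _ (limMod M D) (cone m) f.
  move=> dm e; have [dc cc] := cone_compatible pD dm; split=> //.
  split=> [x Dx|x y Dx Dy xy]; first exact: (cong_domr (cM x) (e x Dx)).
  apply: (cong_trans (cM y) (pre_meq hM xy (cong_sym (cM x) (e x Dx)))).
  exact: (cong_trans (cM y) (cc x y Dx Dy xy) (e y Dy)).
split=> [m m' mm'|m m' dm dm'|a m dm]; apply: eqD.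
- exact: (cong_doml (cM p) mm').
- by move=> x /pD px; apply: (pre_meq hM).
- exact: (cong_add (cM p)).
- by move=> x /pD px; case: (pre_lin hM px) => _ lin _; apply: lin.
- exact: (cong_scale (cM p)).
- by move=> x /pD px; case: (pre_lin hM px) => _ _; apply.
Qed.

Lemma under_pre : IsPrePMod (under_pm M).
Proof.
split=> [p|p q pq||p q r pq qr x].
- exact: lim_cong.
- by apply: lim_res_lin => x; apply: way_below_trl.
- by [].
- by apply: lim_meq_sub => y; apply: way_below_trl (le_trans pq qr).
Qed.

Lemma jlow_presheaf : IsPresheaf (jlow M).
Proof.
split=> [U oU|U V oU oV VU||U V W oU oV oW VU WV s].
- exact: lim_cong.
- exact: lim_res_lin.
- by [].
- by apply: lim_meq_sub => x /WV; apply: VU.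
Qed.

(** Cones go one way, evaluation at [T p] the other. A cone evaluated at [T p] is a structure map of
    [M]; conversely a compatible family agrees above [T p] with the cone on its value at [T p]. *)
Lemma under_interleaved (T : P -> P) :
  Translation T -> (forall p, way_below p (T p)) ->
  pm_interleaved T M (under_pm M).
Proof.
move=> trT wT; have [mT iT] := trT; have cM := pre_cong hM.
have sub p x : way_below p x -> p <= x by exact: way_below_le.
pose a p (m : car (pm M p)) : car (pm (under_pm M) p) := cone m.
pose b p (f : car (pm (under_pm M) p)) : car (pm M (T p)) := f (T p).
apply: (pm_interleaved_factor hM under_pre trT (a := a) (b := b)).
- split=> [p|p q pq m dm]; first exact: (cone_lin (sub p)).
  have [cc dc] := cone_compatible (sub p) dm.
  have dpq : mdom (M $[p --> q] m) by apply: pre_meq.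
  split; [|exact: (cone_compatible (sub q) dpq)|].
    have [] := lim_meq_sub (E := way_below q) _ (lin_meq (cone_lin (sub p)) dm) => //.
    by move=> x; apply: way_below_trl.
  move=> x /way_below_le qx; apply: (cong_sym (cM x)).
  exact: (pre_comp hM).
- split=> [p|p q pq f [[df cf] _ _]]; first exact: (lim_eval_lin (wT p)).
  apply: cf; [exact: wT|exact: way_below_trl (wT q)|exact: mT].
- by move=> p m dm; apply: pre_meq.
- move=> p f [[df cf] _ _].
  have wTx x : way_below (T p) x -> way_below p x by apply: way_below_trl.
  have cf' : compatible (way_below (T p)) f.
    by split=> [x /wTx|x y /wTx px /wTx py]; auto.
  split=> //; last by move=> x Tx; apply: cf; [exact: wT|exact: wTx|exact: sub].
  exact: (cone_compatible (sub (T p)) (df (T p) (wT p))).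
Qed.

(** The unshifted map evaluates a germ of a compatible family at its base point. Backwards, an
    element at [p] gives a cone over the interior of the up-set of [p], an open set containing
    [T p], and so a germ there. *)
Lemma jstar_jlow_interleaved (T : P -> P) : ContinuousPoset (P := P) ->
  Translation T -> (forall p, way_below p (T p)) ->
  pm_interleaved T M (jstar (jlow M)).
Proof.
move=> hP trT wT; have [mT iT] := trT; have cM := pre_cong hM.
have hJ := jlow_presheaf; have oI p := scott_int_open (Up p).
have upI p x : ScottInt (Up p) x -> p <= x by exact: scott_int_Up.
have IT p : ScottInt (Up p) (T p) by apply: way_below_scott_int.
pose b p (m : car (pm M p)) : car (pm (jstar (jlow M)) (T p)) :=
  existT _ (ScottInt (Up p)) (cone m).
pose a p (s : car (pm (jstar (jlow M)) p)) : car (pm M p) := projT2 s p.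
apply: pm_interleaved_sym.
apply: (pm_interleaved_factor (jstar_pre hJ) hM trT (a := a) (b := b)).
- split=> [p|p q pq [U f] [[/= [upU _] Up] [[df cf] _ _] _ _ _]]; last first.
    by apply: cf => //; apply: upU pq.
  split.
  + by move=> [U f] [V g] [_ _ _ _ [W [_ Wp _ _ [_ _ e]]]]; apply: e.
  + move=> [U f] [V g] [[/= oU Up] [[df _] _ _] _ _ _].
    move=> [[/= oV Vp] [[dg _] _ _] _ _ _].
    by apply: (cong_add (cM p)); [apply: df|apply: dg].
  + move=> c [U f] [[/= oU Up] [[df _] _ _] _ _ _].
    by apply: (cong_scale (cM p)); apply: df.
- split=> [p|p q pq m dm].
    have [ceq cadd cscale] := cone_lin (upI p).
    split=> [m m' mm'|m m' dm dm'|c m dm].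
    + by apply: (stalk_meq hJ) => //; apply: ceq.
    + have oII := scott_open_cap (oI p) (oI p).
      have dmm : mdom (madd m m') by apply: (cong_add (cM p)).
      have sII : subs (capS (ScottInt (Up p)) (ScottInt (Up p))) (ScottInt (Up p)).
        by move=> x [].
      apply: (stalk_trans hJ (stalk_res hJ (oI p) oII sII (conj (IT p) (IT p)) _)).
        exact: ceq.
      apply: (stalk_meq hJ) => //.
      exact: (lim_meq_sub sII (cadd m m' dm dm')).
    + by apply: (stalk_meq hJ) => //; apply: cscale.
  have dpq : mdom (M $[p --> q] m) by apply: pre_meq.
  have Iq : ScottInt (Up p) (T q) by apply: (oI p).1 (IT p) (mT _ _ pq).
  have [ceqp _ _] := cone_lin (upI p); have [ceqq _ _] := cone_lin (upI q).
  have IS := subs_scott_int_UpS pq.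
  apply: (stalk_trans hJ (stalk_res hJ (oI p) (oI q) IS (IT q) (ceqp _ _ dm))).
  apply: (stalk_meq hJ) => //.
  split; [|exact: (cone_compatible (upI q) dpq)|].
    by have [] := lim_meq_sub IS (ceqp _ _ dm).
  by move=> x /upI qx; apply: (cong_sym (cM x)); apply: (pre_comp hM).
(* On the interior of the up-set of [p], which lies in [U], the family [f] coincides with the cone
   on [f p]. *)
- move=> p [U f] [[oU Up] df _ _ _]; rewrite /= in oU Up df; have [[dfx cf] _ _] := df.
  have IU := subs_scott_int_Up oU Up.
  apply: (stalk_sym hJ).
  apply: (stalk_trans hJ (stalk_res hJ oU (oI p) IU (IT p) df)).
  apply: (stalk_meq hJ) => //; split.
  + by have [] := lim_meq_sub IU df.
  + exact: (cone_compatible (upI p) (dfx p Up)).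
  + move=> x Ix; apply: (cong_sym (cM x)).
    by apply: cf => //; [apply: IU|apply: upI].
- by move=> p m dm; apply: pre_meq.
Qed.

End Limits.

(** * Stalks compared with sections over interiors of principal up-sets *)

Section SectionsOverInteriors.
Context {k : comPzRingType} {d : Order.disp_t} {P : porderType d}.
Local Open Scope order_scope.

(** The interior of the up-set of [p] lies in every open neighbourhood of [p], so germs at [p]
    restrict to it; it contains [T p], so its sections have germs there. It need not contain [p],
    whence the shift. *)
Lemma jstar_jshriek_interleaved (F : Sheaf k P) (T : P -> P) :
  ContinuousPoset (P := P) -> IsPresheaf F ->
  Translation T -> (forall p, way_below p (T p)) ->
  pm_interleaved T (jstar F) (jshriek F).
Proof.
move=> hP hF trT wT; have [mT iT] := trT.
have oI (p : P) := scott_int_open (Up p); have cI (p : P) := psh_cong hF (oI p).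
have IT p : ScottInt (Up p) (T p) by apply: way_below_scott_int.
pose a p (s : car (pm (jstar F) p)) : car (pm (jshriek F) p) :=
  @Defs.res _ _ _ F _ (ScottInt (Up p)) (projT2 s).
pose b p (s : car (pm (jshriek F) p)) : car (pm (jstar F) (T p)) :=
  existT _ (ScottInt (Up p)) s.
apply: (pm_interleaved_factor (jstar_pre hF) (jshriek_pre hF) trT (a := a) (b := b)).
- split=> [p|p q pq [U s] [[/= oU Up] ds _ _ _]]; last first.
    by apply: (psh_comp hF) => //; [exact: subs_scott_int_Up|exact: subs_scott_int_UpS].
  split.
  + move=> [U s] [V t] [[/= oU Up] ds [oV Vp] dt [W [oW Wp WU WV e]]].
    by apply: (psh_meq_shrink hF oU oV oW) => //; apply: subs_scott_int_Up.
  + move=> [U s] [V t] [[/= oU Up] ds _ _ _] [[/= oV Vp] dt _ _ _].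
    have oUV := scott_open_cap oU oV.
    have IUV := subs_scott_int_Up oUV (conj Up Vp).
    have [UVU UVV] := (@capSl _ _ U V, @capSr _ _ U V).
    have [_ lin _] := psh_lin hF oUV (oI p) IUV.
    have ds' := psh_meq hF oU oUV UVU ds.
    have dt' := psh_meq hF oV oUV UVV dt.
    have es := psh_comp hF oU oUV (oI p) UVU IUV ds.
    have et := psh_comp hF oV oUV (oI p) UVV IUV dt.
    exact: (cong_trans (cI p) (lin _ _ ds' dt') (cong_add (cI p) es et)).
  + move=> c [U s] [[/= oU Up] ds _ _ _].
    by have [_ _] := psh_lin hF oU (oI p) (subs_scott_int_Up oU Up); apply.
- split=> [p|p q pq s ds].
    split=> [s t st|s t ds dt|c s ds].
    + by apply: (stalk_meq hF).
    + have oII := scott_open_cap (oI p) (oI p).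
      have sII := @capSl _ _ (ScottInt (Up p)) (ScottInt (Up p)).
      have dst := cong_add (cI p) ds dt.
      apply: (stalk_trans hF (stalk_res hF (oI p) oII sII (conj (IT p) (IT p)) dst)).
      have e := psh_madd_res hF (oI p) oII sII ds dt.
      exact: (stalk_meq hF oII (conj (IT p) (IT p)) e).
    + exact: (stalk_meq hF (oI p) (IT p) (cong_scale (cI p) c ds)).
  exact: (stalk_res hF (oI p) (oI q) (subs_scott_int_UpS pq) (IT q) ds).
- move=> p [U s] [[oU Up] ds _ _ _]; rewrite /= in oU Up ds; apply: (stalk_sym hF).
  exact: (stalk_res hF oU (oI p) (subs_scott_int_Up oU Up) (IT p) ds).
- move=> p s ds.
  exact: (psh_meq hF (oI p) (oI (T p)) (subs_scott_int_UpS (iT p)) ds).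
Qed.

End SectionsOverInteriors.

(** * Directed colimits by formal sums: the upper module *)

Section Colimits.
Context {k : comPzRingType} {d : Order.disp_t} {P : porderType d}.
Local Open Scope order_scope.

Section ModAxioms.
Variable A : Mod k.
Hypothesis hA : IsMod A.
Implicit Types x y z : car A.

Lemma mod_dom0 : mdom (mzero A).
Proof. by case: hA => _ [_ []]. Qed.

Lemma mod_addA x y z : mdom x -> mdom y -> mdom z ->
  meq (madd x (madd y z)) (madd (madd x y) z).
Proof.
by case: hA => _ [_ [_ [_ [_ [_ ax]]]]] dx dy dz; case: (ax x y z dx dy dz).
Qed.

Lemma mod_add0 x : mdom x -> meq (madd (mzero A) x) x.
Proof. by case: hA => _ [_ [_ [_ [_ [_ ax]]]]] dx; case: (ax x x x dx dx dx). Qed.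

Lemma mod_addr0 x : mdom x -> meq (madd x (mzero A)) x.
Proof.
move=> dx; have := mod_add0 dx.
case: (hA) => _ [tr [d0 [_ [_ [_ ax]]]]].
by case: (ax x (mzero A) x dx d0 dx) => _ comm _ _ _; apply: tr.
Qed.

Lemma mod_scale_lin c : IsLin (M := A) (N := A) (mscale c).
Proof.
have cA := IsMod_cong hA; case: (hA) => _ [_ [_ [_ [_ [_ ax]]]]].
split=> [x y|x y dx dy|a x dx]; first exact: cong_scale.
  by have [_ _ _ _ /(_ c c) []] := ax x y y dx dy dy.
have [_ _ _ _ sc] := ax x x x dx dx dx.
have [_ ca _ _] := sc c a; have [_ ac _ _] := sc a c.
by apply: (cong_trans cA (cong_sym cA ca)); rewrite mulrC.
Qed.

End ModAxioms.

Lemma InL_cat (X : Type) (e : X) l1 l2 :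
  InL e (l1 ++ l2) <-> InL e l1 \/ InL e l2.
Proof. by elim: l1 => [|x l1 IH] /=; [tauto|rewrite IH; tauto]. Qed.

Lemma InL_map (X Y : Type) (f : X -> Y) y l :
  InL y (map f l) -> exists2 x, InL x l & y = f x.
Proof.
elim: l => //= x l IH [<-|/IH [z zl ->]]; first by exists x => //; left.
by exists z => //; right.
Qed.

Variable M : PMod k P.
Hypothesis hM : IsPMod M.
Implicit Types (D E : P -> Prop) (p q z w : P) (l : seq {x : P & car (pm M x)}).

Let hM' : IsPrePMod M := IsPMod_pre hM.
Let mM p : IsMod (pm M p). Proof. by case: hM. Qed.
Let cM p : IsCong (pm M p) := pre_cong hM' p.

Definition push z l : car (pm M z) :=
  msum [seq M $[projT1 e --> z] (projT2 e) | e <- l].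

(** What makes [push z l] meaningful: structure maps are constrained only along [<=] and on elements
    of the module. *)
Definition below z l : Prop :=
  forall e, InL e l -> projT1 e <= z /\ mdom (projT2 e).

Definition supported D l : Prop :=
  forall e, InL e l -> D (projT1 e) /\ mdom (projT2 e).

Lemma below_cat z l1 l2 : below z l1 -> below z l2 -> below z (l1 ++ l2).
Proof. by move=> h1 h2 e /InL_cat [/h1|/h2]. Qed.

Lemma below_le z w l : z <= w -> below z l -> below w l.
Proof. by move=> zw h e /h [ez de]; split=> //; apply: le_trans zw. Qed.

Lemma below_consE z e l : below z (e :: l) ->
  [/\ mdom (M $[projT1 e --> z] (projT2 e)), projT1 e <= z, mdom (projT2 e) &
      below z l].
Proof.
move=> h; have [ez de] := h e (or_introl erefl); split=> //.
  exact: (pre_meq hM').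
by move=> e' e'l; apply: h; right.
Qed.

Lemma push_dom z l : below z l -> mdom (push z l).
Proof.
elim: l => [_|e l IH /below_consE [de _ _ /IH dl]]; first exact: mod_dom0.
exact: (cong_add (cM z)).
Qed.

Lemma push1 p z (m : car (pm M p)) : p <= z -> mdom m ->
  meq (push z [:: existT _ p m]) (M $[p --> z] m).
Proof. by move=> pz dm; apply: mod_addr0 => //; apply: pre_meq. Qed.

Lemma push_cat z l1 l2 : below z l1 -> below z l2 ->
  meq (push z (l1 ++ l2)) (madd (push z l1) (push z l2)).
Proof.
elim: l1 => [_ b2|e l1 IH /below_consE [de _ _ b1] b2] /=.
  by apply/(cong_sym (cM z))/(mod_add0 (mM z)); apply: push_dom.
apply: (cong_trans (cM z) (cong_add (cM z) de (IH b1 b2))).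
by apply: (mod_addA (mM z)) => //; apply: push_dom.
Qed.

Lemma push_comp z w l : z <= w -> below z l ->
  meq (M $[z --> w] (push z l)) (push w l).
Proof.
move=> zw; have lzw := pre_lin hM' zw.
elim: l => [_|e l IH /below_consE [de ez de' b]].
  exact: (lin0 (mM z) (mM w) lzw).
have [_ add _] := lzw.
apply: (cong_trans (cM w) (add _ _ de (push_dom b))).
by apply: (cong_add (cM w)); [apply: (pre_comp hM')|apply: IH].
Qed.

Definition scale_formal (c : k) l :=
  [seq existT (fun x => car (pm M x)) (projT1 e) (mscale c (projT2 e)) | e <- l].

Lemma push_scale c z l : below z l ->
  meq (push z (scale_formal c l)) (mscale c (push z l)).
Proof.
have lc := mod_scale_lin (mM z) c.
elim: l => [_|e l IH /below_consE [de ez de' b]].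
  exact/(cong_sym (cM z))/(lin0 (mM z) (mM z) lc).
have [_ add _] := lc.
apply: (cong_trans (cM z) _ (cong_sym (cM z) (add _ _ de (push_dom b)))).
apply: (cong_add (cM z)); last exact: IH.
by have [_ _ sc] := pre_lin hM' ez; apply: sc.
Qed.

Lemma below_scale c z l : below z l -> below z (scale_formal c l).
Proof.
move=> b x xl; have [e el ->] := InL_map xl; have [ez de] := b e el; split=> //.
exact: (cong_scale (cM _)).
Qed.

Lemma supported_scale D c l : supported D l -> supported D (scale_formal c l).
Proof.
move=> b x xl; have [e el ->] := InL_map xl; have [ez de] := b e el; split=> //.
exact: (cong_scale (cM _)).
Qed.

Lemma supported_cat D l1 l2 :
  supported D l1 -> supported D l2 -> supported D (l1 ++ l2).
Proof. by move=> h1 h2 e /InL_cat [/h1|/h2]. Qed.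

(** Splits the bound on the concatenated list into one [below] per side, the form in which the
    lemmas on [push] take it. *)
Lemma colim_meqP D l1 l2 : @meq _ (colimMod M D) l1 l2 <->
  [/\ supported D l1, supported D l2 & exists z,
    [/\ D z, below z l1, below z l2 & meq (push z l1) (push z l2)]].
Proof.
split=> [[s1 s2 [z [Dz le_z e]]]|[s1 s2 [z [Dz b1 b2 e]]]]; split=> //; exists z.
  by split=> // x xl; split; [apply: le_z; apply/InL_cat; left|case: (s1 x xl)|
    apply: le_z; apply/InL_cat; right|case: (s2 x xl)].
by split=> // x /InL_cat [/b1 []|/b2 []].
Qed.

Lemma push_meq_le z w l1 l2 : z <= w -> below z l1 -> below z l2 ->
  meq (push z l1) (push z l2) -> meq (push w l1) (push w l2).
Proof.
move=> zw b1 b2 e.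
apply: (cong_trans (cM w) (cong_sym (cM w) (push_comp zw b1))).
by apply: (cong_trans (cM w) (pre_meq hM' zw e)); apply: push_comp.
Qed.

(** Equalities witnessed at two stages are moved by [push_meq_le] to a common upper bound in [D]. *)
Lemma colim_cong D : Directed D -> IsCong (colimMod M D).
Proof.
move=> dirD; split.
- move=> l1 l2 /colim_meqP [s1 s2 [z [Dz b1 b2 e]]]; apply/colim_meqP.
  by split=> //; exists z; split=> //; apply: (cong_sym (cM z)).
- move=> l1 l2 l3 /colim_meqP [s1 s2 [z [Dz b1 b2 e]]].
  move=> /colim_meqP [_ s3 [z' [Dz' b2' b3 e']]]; apply/colim_meqP; split=> //.
  have [w [Dw zw z'w]] := dirD.2 _ _ Dz Dz'.
  exists w; split=> //; [exact: below_le b1|exact: below_le b3|].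
  apply: (cong_trans (cM w) (push_meq_le zw b1 b2 e)).
  exact: push_meq_le e'.
- move=> l1 l1' l2 l2' /colim_meqP [s1 s1' [z [Dz b1 b1' e]]].
  move=> /colim_meqP [s2 s2' [z' [Dz' b2 b2' e']]]; apply/colim_meqP.
  have [w [Dw zw z'w]] := dirD.2 _ _ Dz Dz'.
  have [c1 c1'] := (below_le zw b1, below_le zw b1').
  have [c2 c2'] := (below_le z'w b2, below_le z'w b2').
  split; [exact: supported_cat|exact: supported_cat|].
  exists w; split=> //; [exact: below_cat|exact: below_cat|].
  apply: (cong_trans (cM w) (push_cat c1 c2)).
  apply: (cong_trans (cM w) _ (cong_sym (cM w) (push_cat c1' c2'))).
  by apply: (cong_add (cM w)); [apply: push_meq_le e|apply: push_meq_le e'].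
- move=> c l1 l2 /colim_meqP [s1 s2 [z [Dz b1 b2 e]]]; apply/colim_meqP.
  split; [exact: supported_scale|exact: supported_scale|].
  exists z; split=> //; [exact: below_scale|exact: below_scale|].
  apply: (cong_trans (cM z) (push_scale c b1)).
  apply: (cong_trans (cM z) _ (cong_sym (cM z) (push_scale c b2))).
  exact: (cong_scale (cM z)).
Qed.

Lemma colim_meq_sub D E l1 l2 : (forall x, D x -> E x) ->
  @meq _ (colimMod M D) l1 l2 -> @meq _ (colimMod M E) l1 l2.
Proof.
move=> DE /colim_meqP [s1 s2 [z [Dz b1 b2 e]]]; apply/colim_meqP.
by split; [move=> x /s1 [/DE]|move=> x /s2 [/DE]|exists z; split=> //; apply: DE].
Qed.

Hypothesis hP : ContinuousPoset (P := P).

Lemma over_pre : IsPrePMod (over_pm M).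
Proof.
have dir p : Directed (fun x => way_below x p) := (hP p).1.
split=> [p|p q pq||p q r pq qr l dl].
- exact: colim_cong.
- have sub x : way_below x p -> way_below x q by move=> xp; apply: way_below_trr pq.
  have cq := colim_cong (dir q).
  split=> [l1 l2|l1 l2 dl1 dl2|c l dl]; first exact: colim_meq_sub.
    by apply: (cong_add cq); apply: colim_meq_sub sub _.
  by apply: (cong_scale cq); apply: colim_meq_sub sub _.
- by [].
- by apply: colim_meq_sub dl => x xp; apply: way_below_trr (le_trans pq qr).
Qed.

(** A formal sum over points way below [p] can be added up at [p]. Backwards, since [p] is way below
    [T p], an element at [p] is itself a one-term formal sum for [T p]. *)
Lemma over_interleaved (T : P -> P) :
  Translation T -> (forall p, way_below p (T p)) ->
  pm_interleaved T M (over_pm M).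
Proof.
move=> trT wT; have [mT iT] := trT.
pose a p (l : car (pm (over_pm M) p)) : car (pm M p) := push p l.
pose b p (m : car (pm M p)) : car (pm (over_pm M) (T p)) := [:: existT _ p m].
have sb p l : supported (fun x => way_below x p) l -> below p l.
  by move=> s e /s [/way_below_le].
have b1 p q (m : car (pm M p)) : p <= q -> mdom m -> below q [:: existT _ p m].
  by move=> pq dm e /= [<-|[]].
have s1 p q (m : car (pm M p)) : way_below p q -> mdom m ->
    supported (fun x => way_below x q) [:: existT _ p m].
  by move=> pq dm e /= [<-|[]].
apply: pm_interleaved_sym.
apply: (pm_interleaved_factor over_pre hM' trT (a := a) (b := b)).
- split=> [p|p q pq l /colim_meqP [/sb bl _ _]]; last exact: push_comp.
  split.
  + move=> l1 l2 /colim_meqP [_ _ [z [/way_below_le zp bl1 bl2 e]]].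
    exact: push_meq_le e.
  + move=> l1 l2 /colim_meqP [/sb bl1 _ _] /colim_meqP [/sb bl2 _ _].
    exact: push_cat.
  + move=> c l /colim_meqP [/sb bl _ _]; exact: push_scale.
(* A one-term sum is compared with [l] at a chosen stage [q]; the linearity checks take [q] to be
   [p]. *)
- have eqb p q (m : car (pm M p)) l : way_below q (T p) -> p <= q -> mdom m ->
      supported (fun x => way_below x (T p)) l -> below q l ->
      meq (M $[p --> q] m) (push q l) ->
      @meq _ (colimMod M (fun x => way_below x (T p))) (b p m) l.
    move=> qT pq dm sl bl e; apply/colim_meqP; split=> //.
      by apply: s1 => //; apply: way_below_trl qT.
    exists q; split=> //; first exact: b1.
    exact: (cong_trans (cM q) (push1 pq dm) e).
  split=> [p|p q pq m dm].
    split=> [m m' mm'|m m' dm dm'|c m dm].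
    + have dm := cong_doml (cM p) mm'; have dm' := cong_domr (cM p) mm'.
      apply: (eqb p p) => //; [exact: s1|exact: b1|].
      apply: (cong_trans (cM p) (pre_meq hM' (lexx p) mm')).
      exact: (cong_sym (cM p) (push1 (lexx p) dm')).
    + have dmm := cong_add (cM p) dm dm'.
      have [bm bm'] := (b1 p p m (lexx p) dm, b1 p p m' (lexx p) dm').
      apply: (eqb p p) => //; [|exact: below_cat|].
        by apply: supported_cat; apply: s1.
      have [_ add _] := pre_lin hM' (lexx p).
      apply: (cong_trans (cM p) (add _ _ dm dm')).
      apply: (cong_trans (cM p) _ (cong_sym (cM p) (push_cat bm bm'))).
      by apply: (cong_add (cM p)); apply: (cong_sym (cM p)); apply: push1.
    + have dcm := cong_scale (cM p) c dm.
      apply: (eqb p p) => //; [exact: s1|exact: b1|].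
      exact: (cong_sym (cM p) (push1 (lexx p) dcm)).
  have dpq : mdom (M $[p --> q] m) by apply: pre_meq.
  apply/colim_meqP; split; [|exact: s1|].
    by apply: s1 => //; apply: way_below_trl (wT q).
  exists q; split=> //; [exact: b1|exact: b1|].
  apply: (cong_trans (cM q) (push1 pq dm)).
  apply: (cong_trans (cM q) _ (cong_sym (cM q) (push1 (lexx q) dpq))).
  exact: (cong_sym (cM q) (pre_id hM' dpq)).
- move=> p l /colim_meqP [sl _ _]; have bl := sb p l sl; have dl := push_dom bl.
  apply/colim_meqP; split; [exact: s1| |].
    move=> e /sl [ep de]; split=> //; exact: way_below_trr ep (iT p).
  (* The index set is now that of [T p], so [p] itself is an available stage. *)
  exists p; split=> //; first exact: b1.
  apply: (cong_trans (cM p) (push1 (lexx p) dl)); exact: (pre_id hM').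
- by move=> p m dm; apply: push1.
Qed.

End Colimits.

(** * The equalities of distances *)

Unset Implicit Arguments.
Local Open Scope ring_scope.

Theorem mainTheorem19 (k : comPzRingType) (d : Order.disp_t) (P : porderType d)
  (R : realType) (T : R -> P -> P)
  (hP : ContinuousPoset (P := P))
  (hT : forall e : R, 0 <= e -> Translation (T e) /\ ScottContinuous (T e))
  (hsl : SuperlinearFamily T) (h1 : TR1 T) (h2 : TR2 T) :
  (forall F G : Sheaf k P, IsSheaf F -> IsSheaf G ->
     d_sigma T F G = d_a T (jstar F) (jstar G) /\
     d_a T (jstar F) (jstar G) = d_a T (jshriek F) (jshriek G)) /\
  (forall M N : PMod k P, IsPMod M -> IsPMod N ->
     [/\ d_a T M N = d_a T (under_pm M) (under_pm N),
         d_a T M N = d_a T (over_pm M) (over_pm N) &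
         d_a T M N = d_sigma T (jlow M) (jlow N)]).
Proof.
have trT (e : R) : 0 <= e -> Translation (T e) by move=> /hT [].
have dE (F G : Sheaf k P) : IsPresheaf F -> IsPresheaf G ->
    d_sigma T F G = d_a T (jstar F) (jstar G).
  (* The two infima range over the same set of parameters. *)
  move=> hF hG; rewrite /d_sigma /d_a; congr (ereal_inf (image _ _)).
  apply/seteqP; split=> e /= [e0 he]; split=> //; have [tr sc] := hT e e0.
    exact/(sh_interleaved_stalks hP hF hG tr sc).
  exact/(sh_interleaved_stalks hP hF hG tr sc).
split=> [F G /IsSheaf_presheaf hF /IsSheaf_presheaf hG|M N hM hN].
- split; first exact: dE.
  apply: (d_a_infinitesimal trT hsl) => [||||e e0|e e0]; try exact: jstar_pre.
  + exact: jshriek_pre.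
  + exact: jshriek_pre.
  + by apply: jstar_jshriek_interleaved => //; [apply/trT/ltW|apply: h2].
  + by apply: jstar_jshriek_interleaved => //; [apply/trT/ltW|apply: h2].
- have [pM pN] := (IsPMod_pre hM, IsPMod_pre hN).
  have close X X' Y Y' := @d_a_infinitesimal k d P R T trT hsl X Y X' Y'.
  split.
  + apply: close => //; [exact: under_pre|exact: under_pre|move=> e e0..].
      by apply: under_interleaved => //; [apply/trT/ltW|apply: h2].
    by apply: under_interleaved => //; [apply/trT/ltW|apply: h2].
  + apply: close => //; [exact: over_pre|exact: over_pre|move=> e e0..].
      by apply: over_interleaved => //; [apply/trT/ltW|apply: h2].
    by apply: over_interleaved => //; [apply/trT/ltW|apply: h2].
  + have [jM jN] := (jlow_presheaf pM, jlow_presheaf pN).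
    (* The sheaf distance becomes the distance of the stalk modules of [jlow M] and [jlow N], which
       are infinitesimally interleaved with [M] and [N]. *)
    rewrite (dE _ _ jM jN).
    apply: close => //; [exact: jstar_pre|exact: jstar_pre|move=> e e0..].
      by apply: jstar_jlow_interleaved => //; [apply/trT/ltW|apply: h2].
    by apply: jstar_jlow_interleaved => //; [apply/trT/ltW|apply: h2].
Qed.
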